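(* Let $n\ge1$ and $I\subseteq\{1,\dots,n\}$. For any reduced Type $A$ potential $f$ on $Q_{n,I}$, there exists a right-equivalence $\rho\colon f\rightsquigarrow f'$ such that $f'$ is a reduced monomialized Type $A$ potential on $Q_{n,I}$.
   Context: Everything is over $\mathbb C$. For a finite quiver with tail and head maps $t,h$, a path is a product $c_1c_2\cdots c_r$ of arrows with $h(c_i)=t(c_{i+1})$. $\mathbb C\langle\langle Q\rangle\rangle$ is the completion of the path algebra at the ideal generated by the arrows. A potential on $Q$ is a (possibly infinite) $\mathbb C$-linear combination of cyclic paths of length $\geq 2$; it is reduced if it has no terms of path length $2$. Write $W\sim W'$ (cyclically equivalent) if $W-W'$ lies in the closure of the span of commutators. A right-equivalence $\varphi\colon f\rightsquigarrow g$ is an algebra isomorphism $\varphi\colon\mathbb C\langle\langle Q\rangle\rangle\to\mathbb C\langle\langle Q\rangle\rangle$ which restricts to the identity on $\mathbb C$ and satisfies $\varphi(f)\sim g$. For $I\subseteq\{1,\dots,n\}$, $Q_{n,I}$ has vertices $1,\dots,n$, one arrow $i\to i+1$ and one arrow $i+1\to i$ for each $1\le i\le n-1$, and one loop at each vertex $i\notin I$. Put $m=2n-1-|I|$. List from left to right: the loop at $1$ (if $1\notin I$), the pair of arrows between $1,2$, the loop at $2$ (if $2\notin I$), the pair between $2,3$, and so on; this list has $m$ members. If the $k$-th member is a loop, call it $a_k$ and let $b_k$ be the trivial path at its vertex; if it is the pair between $i,i+1$, let $a_k\colon i\to i+1$ and $b_k\colon i+1\to i$. Set $\mathsf x_k=a_kb_k$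 and $\mathsf x_k'=b_ka_k$ for $1\le k\le m$. A potential $f$ contains a cycle $c$ if $f\sim\lambda c+h$ with $\lambda\in\mathbb C^\times$ and no cyclic rotation of $c$ occurs in $h$. A potential on $Q_{n,I}$ is reduced Type $A$ if it is reduced and contains $\mathsf x_i'\mathsf x_{i+1}$ for every $1\le i\le m-1$. It is monomialized Type $A$ if it is cyclically equivalent to $\sum_{i=1}^{m-1}\mathsf x_i'\mathsf x_{i+1}+\sum_{i=1}^m\sum_{j=2}^\infty\kappa_{ij}\mathsf x_i^j$ for some $\kappa_{ij}\in\mathbb C$. *)

(* Defs.v *)
From HB Require Import structures.
From mathcomp Require Import all_boot all_order all_algebra.
From mathcomp Require Import boolp zify.

Set Implicit Arguments.
Unset Strict Implicit.
Unset Printing Implicit Defensive.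

Import GRing.Theory.
Local Open Scope ring_scope.

Record quiver := Quiver {
  vertex : finType;
  arrow : finType;
  qtail : arrow -> vertex;
  qhead : arrow -> vertex
}.

Section Paths.
Variable Q : quiver.
Implicit Types (v : vertex Q) (s : seq (arrow Q)).

Fixpoint composable v s : bool :=
  if s is a :: s' then (qtail a == v) && composable (qhead a) s' else true.

Definition endpoint v s : vertex Q := last v (map (@qhead Q) s).

(* A path is stored as its source together with its sequence of arrows, so
   that the trivial paths at distinct vertices are distinct. *)
Definition qpath := {p : vertex Q * seq (arrow Q) | composable p.1 p.2}.
HB.instance Definition _ := SubCountable.on qpath.
Implicit Types p q : qpath.

Definition psource p : vertex Q := (val p).1.
Definition parrows p : seq (arrow Q) := (val p).2.
Definition plen p : nat := size (parrows p).
Definition ptarget p : vertex Q := endpoint (psource p) (parrows p).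
Definition pclosed p : bool := ptarget p == psource p.

Lemma composable_cat v s1 s2 :
  composable v (s1 ++ s2) = composable v s1 && composable (endpoint v s1) s2.
Proof. by elim: s1 v => [|a s1 IH] v //=; rewrite IH andbA. Qed.

Lemma composable_take i p : composable (psource p) (take i (parrows p)).
Proof.
by have := svalP p; rewrite -{1}(cat_take_drop i (sval p).2) composable_cat => /andP[].
Qed.

Lemma composable_drop i p :
  composable (endpoint (psource p) (take i (parrows p))) (drop i (parrows p)).
Proof.
by have := svalP p; rewrite -{1}(cat_take_drop i (sval p).2) composable_cat => /andP[].
Qed.

Lemma composable1 (a : arrow Q) : composable (qtail a) [:: a].
Proof. by rewrite /= eqxx. Qed.

Definition vpath v : qpath := exist _ (v, [::]) isT.
Definition apath (a : arrow Q) : qpath := exist _ (qtail a, [:: a]) (composable1 a).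

(* The initial segment of length i, and what remains of p after it. *)
Definition ptake i p : qpath := exist _ (_, _) (composable_take i p).
Definition pdrop i p : qpath := exist _ (_, _) (composable_drop i p).

(* Concatenation "first p, then q"; meaningful only if ptarget p = psource q
   (otherwise it returns the junk value p); see monomM. *)
Definition pcomp p q : qpath :=
  insubd p (psource p, parrows p ++ parrows q).

Definition rotation_of (c p : qpath) : Prop :=
  exists2 i, (i <= plen c)%N & p = pcomp (pdrop i c) (ptake i c).

Lemma qpath_inj p q : psource p = psource q -> parrows p = parrows q -> p = q.
Proof.
by move=> e1 e2; apply: val_inj; apply/eqP; rewrite -pair_eqE /= /pair_eq;
   apply/andP; split; apply/eqP.
Qed.

Lemma val_pcomp p q : ptarget p = psource q ->
  val (pcomp p q) = (psource p, parrows p ++ parrows q).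
Proof.
move=> e; rewrite val_insubd /= composable_cat.
have -> : composable (psource p) (parrows p) by exact: (svalP p).
rewrite -/(ptarget p) e.
by have -> : composable (psource q) (parrows q) by exact: (svalP q).
Qed.

Lemma psource_pcomp p q : ptarget p = psource q -> psource (pcomp p q) = psource p.
Proof. by move=> e; rewrite /psource val_pcomp. Qed.

Lemma ptarget_pcomp p q : ptarget p = psource q -> ptarget (pcomp p q) = ptarget q.
Proof.
move=> e; rewrite /ptarget psource_pcomp // {1}/parrows val_pcomp //=.
rewrite /endpoint map_cat last_cat.
exact: (congr1 (fun v => last v _) e).
Qed.

Lemma plen_ptake i p : (i <= plen p)%N -> plen (ptake i p) = i.
Proof. by move=> le; rewrite /plen /parrows /= size_takel. Qed.

Lemma plen_pdrop i p : plen (pdrop i p) = (plen p - i)%N.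
Proof. by rewrite /plen /parrows /= size_drop. Qed.

Lemma ptake_ptake i j p : (j <= i)%N -> ptake j (ptake i p) = ptake j p.
Proof. by move=> le; apply: qpath_inj => //=; rewrite /parrows /= take_takel. Qed.

Lemma ptake_pdrop i j p : ptake i (pdrop j p) = pdrop j (ptake (i + j) p).
Proof.
apply: qpath_inj; rewrite /psource /parrows /= ?take_takel ?leq_addl //.
by rewrite take_drop.
Qed.

Lemma pdrop_pdrop i j p : pdrop i (pdrop j p) = pdrop (i + j) p.
Proof.
apply: qpath_inj; rewrite /psource /parrows /= ?drop_drop // /endpoint.
by rewrite [(i + j)%N]addnC takeD map_cat last_cat.
Qed.

Lemma ptake0 p : ptake 0 p = vpath (psource p).
Proof. by apply: qpath_inj; rewrite /psource /parrows //= take0. Qed.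

Lemma pdrop0 p : pdrop 0 p = p.
Proof. by apply: qpath_inj; rewrite /psource /parrows /= ?take0 ?drop0. Qed.

Lemma ptake_plen p : ptake (plen p) p = p.
Proof. by apply: qpath_inj; rewrite /psource /parrows //= take_size. Qed.

Lemma pdrop_plen p : pdrop (plen p) p = vpath (ptarget p).
Proof. by apply: qpath_inj; rewrite /psource /parrows /= ?take_size ?drop_size. Qed.

Lemma ptarget_ptake i p : ptarget (ptake i p) = psource (pdrop i p).
Proof. by []. Qed.

Lemma pcomp_take_drop i p : pcomp (ptake i p) (pdrop i p) = p.
Proof.
apply: val_inj; rewrite val_pcomp // /parrows /= cat_take_drop.
by case: p => [[v s] h].
Qed.

End Paths.

Arguments ptake {Q}.
Arguments pdrop {Q}.

(* The completion of the path algebra at the arrow ideal: as Q has finitely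
   many arrows, its elements are the arbitrary (infinite) formal linear
   combinations of paths, recorded as the function p |-> coefficient of p. *)
Record cpath_alg (K : fieldType) (Q : quiver) := CPathAlg {
  coef :> qpath Q -> K
}.

Section CompletedPathAlgebra.
Variables (K : fieldType) (Q : quiver).
Notation A := (cpath_alg K Q).
Implicit Types (f g h : A) (p q : qpath Q).

Lemma cpath_algP f g : (forall p, f p = g p) -> f = g.
Proof. by case: f g => [f] [g] /= e; congr CPathAlg; apply: funext. Qed.

HB.instance Definition _ := gen_eqMixin A.
HB.instance Definition _ := gen_choiceMixin A.

Definition cpa_zero : A := CPathAlg (fun=> 0).
Definition cpa_opp f : A := CPathAlg (fun p => - f p).
Definition cpa_add f g : A := CPathAlg (fun p => f p + g p).
Definition cpa_scale (c : K) f : A := CPathAlg (fun p => c * f p).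

(* The unit is the sum of all the trivial paths. *)
Definition cpa_one : A := CPathAlg (fun p => (plen p == 0%N)%:R).

(* The factorizations of p as a product of two paths are given by its
   plen p + 1 cuts. *)
Definition cpa_mul f g : A :=
  CPathAlg (fun p => \sum_(0 <= i < (plen p).+1) f (ptake i p) * g (pdrop i p)).

Fact cpa_addA : associative cpa_add.
Proof. by move=> f g h; apply: cpath_algP => p /=; rewrite addrA. Qed.
Fact cpa_addC : commutative cpa_add.
Proof. by move=> f g; apply: cpath_algP => p /=; rewrite addrC. Qed.
Fact cpa_add0 : left_id cpa_zero cpa_add.
Proof. by move=> f; apply: cpath_algP => p /=; rewrite add0r. Qed.
Fact cpa_addN : left_inverse cpa_zero cpa_opp cpa_add.
Proof. by move=> f; apply: cpath_algP => p /=; rewrite addNr. Qed.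

HB.instance Definition _ :=
  GRing.isZmodule.Build A cpa_addA cpa_addC cpa_add0 cpa_addN.

Fact sum_triangle m (F : nat -> nat -> K) :
  \sum_(0 <= j < m) \sum_(j <= i < m) F j i =
  \sum_(0 <= i < m) \sum_(0 <= j < i.+1) F j i.
Proof.
elim: m => [|m IH]; first by rewrite !big_geq.
rewrite !big_nat_recr //= -IH [X in _ + (X + _)]big_geq // add0r addrA; congr (_ + _).
rewrite -big_split /=; apply: eq_big_nat => j /andP[_ lt].
by rewrite big_nat_recr //= ltnW.
Qed.

Fact cpa_mulA : associative cpa_mul.
Proof.
move=> f g h; apply: cpath_algP => p /=; set n := plen p.
pose F j i := f (ptake j p) * g (pdrop j (ptake i p)) * h (pdrop i p).
transitivity (\sum_(0 <= j < n.+1) \sum_(j <= i < n.+1) F j i).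
  apply: eq_big_nat => j /andP[_]; rewrite ltnS => lejn.
  have -> : \sum_(j <= i < n.+1) F j i = \sum_(0 <= i < n.+1 - j) F j (i + j)%N.
    by rewrite -{1}[j]add0n big_addn.
  rewrite plen_pdrop -/n -subSn // big_distrr /=.
  apply: eq_big_nat => i _.
  by rewrite /F ptake_pdrop pdrop_pdrop mulrA.
transitivity (\sum_(0 <= i < n.+1) \sum_(0 <= j < i.+1) F j i); last first.
  apply: eq_big_nat => i /andP[_]; rewrite ltnS => lein.
  rewrite plen_ptake // big_distrl /=.
  by apply: eq_big_nat => j /andP[_ lji]; rewrite /F ptake_ptake.
exact: sum_triangle.
Qed.

Fact cpa_mul1l : left_id cpa_one cpa_mul.
Proof.
move=> f; apply: cpath_algP => p /=.
rewrite big_nat_recl //= pdrop0 plen_ptake // eqxx mul1r big_nat big1 ?addr0 //.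
by move=> i /andP[_ lt]; rewrite plen_ptake // mul0r.
Qed.

Fact cpa_mul1r : right_id cpa_one cpa_mul.
Proof.
move=> f; apply: cpath_algP => p /=.
rewrite big_nat_recr //= ptake_plen plen_pdrop subnn eqxx mulr1.
rewrite big_nat big1 ?add0r //.
by move=> i /andP[_ lt]; rewrite plen_pdrop subn_eq0 leqNgt lt mulr0.
Qed.

Fact cpa_mulDl : left_distributive cpa_mul +%R.
Proof.
move=> f g h; apply: cpath_algP => p /=.
by rewrite -big_split; apply: eq_bigr => i _; rewrite mulrDl.
Qed.

Fact cpa_mulDr : right_distributive cpa_mul +%R.
Proof.
move=> f g h; apply: cpath_algP => p /=.
by rewrite -big_split; apply: eq_bigr => i _; rewrite mulrDr.
Qed.

(* The ring is trivial if Q has no vertex, whence pzRingType. *)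
HB.instance Definition _ := GRing.Zmodule_isPzRing.Build A
  cpa_mulA cpa_mul1l cpa_mul1r cpa_mulDl cpa_mulDr.

Fact cpa_scaleA a b f : cpa_scale a (cpa_scale b f) = cpa_scale (a * b) f.
Proof. by apply: cpath_algP => p /=; rewrite mulrA. Qed.
Fact cpa_scale1 : left_id 1 cpa_scale.
Proof. by move=> f; apply: cpath_algP => p /=; rewrite mul1r. Qed.
Fact cpa_scaleDr : right_distributive cpa_scale +%R.
Proof. by move=> a f g; apply: cpath_algP => p /=; rewrite mulrDr. Qed.
Fact cpa_scaleDl f : {morph cpa_scale^~ f : a b / a + b}.
Proof. by move=> a b; apply: cpath_algP => p /=; rewrite mulrDl. Qed.

HB.instance Definition _ := GRing.Zmodule_isLmodule.Build K A
  cpa_scaleA cpa_scale1 cpa_scaleDr cpa_scaleDl.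

Lemma cpa_scaleAl (a : K) f g : a *: (f * g) = (a *: f) * g.
Proof.
apply: cpath_algP => p /=; rewrite big_distrr /=.
by apply: eq_bigr => i _; rewrite mulrA.
Qed.

Lemma cpa_scaleAr (a : K) f g : a *: (f * g) = f * (a *: g).
Proof.
apply: cpath_algP => p /=; rewrite big_distrr /=.
by apply: eq_bigr => i _; rewrite mulrCA.
Qed.

Definition monom p : A := CPathAlg (fun q => (q == p)%:R).

Lemma monomM p q :
  monom p * monom q = if ptarget p == psource q then monom (pcomp p q) else 0.
Proof.
apply: cpath_algP => r; rewrite [LHS]/=.
case: eqP => [e|ne]; last first.
  apply: big1 => i _; case: eqP => [e1|]; last by rewrite mul0r.
  by case: eqP => [e2|]; rewrite ?mulr0 //; case: ne; rewrite -e1 -e2.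
have pl : plen (pcomp p q) = (plen p + plen q)%N.
  by rewrite /plen /parrows val_pcomp //= size_cat.
have ps : psource (pcomp p q) = psource p by rewrite /psource val_pcomp.
have pa : parrows (pcomp p q) = parrows p ++ parrows q.
  by rewrite {1}/parrows val_pcomp.
have tp : ptake (plen p) (pcomp p q) = p.
  apply: qpath_inj => //.
  by rewrite -[LHS]/(take _ (parrows _)) pa take_size_cat.
have dq : pdrop (plen p) (pcomp p q) = q.
  apply: qpath_inj; first by rewrite -ptarget_ptake tp.
  by rewrite -[LHS]/(drop _ (parrows _)) pa drop_size_cat.
rewrite /=; case: (r =P pcomp p q) => [->|ne].
  rewrite pl (bigD1_seq (plen p)) ?iota_uniq //=; last first.
    by rewrite mem_index_iota ltnS leq_addr.
  rewrite tp dq !eqxx mulr1 big_nat_cond big1 ?addr0 // => i /andP[/andP[_ li] ni].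
  case: eqP => [e1|]; rewrite ?mul0r //.
  by case/eqP: ni; rewrite -e1 plen_ptake // pl.
apply: big1 => i _; case: eqP => [e1|]; last by rewrite mul0r.
by case: eqP => [e2|]; rewrite ?mulr0 //; case: ne; rewrite -e1 -e2 pcomp_take_drop.
Qed.

(* f lies in the N-th power of the (completed) arrow ideal. These powers form
   a basis of neighbourhoods of 0; closures and limits are taken for them. *)
Definition in_adic N f : Prop := forall p, (plen p < N)%N -> f p = 0.

Definition adic_lim (u : nat -> A) (f : A) : Prop :=
  forall N, exists k0, forall k, (k0 <= k)%N -> in_adic N (f - u k).

Definition adic_closure (S : A -> Prop) (f : A) : Prop :=
  forall N, exists2 s, S s & in_adic N (f - s).

Definition commutator_span (f : A) : Prop :=
  exists k (c : 'I_k -> K) (x y : 'I_k -> A),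
    f = \sum_(i < k) c i *: (x i * y i - y i * x i).

Definition cyc_equiv f g : Prop := adic_closure commutator_span (f - g).

Definition potential f : Prop :=
  forall p, f p != 0 -> pclosed p && (2 <= plen p)%N.

Definition reduced f : Prop := forall p, plen p = 2 -> f p = 0.

Definition contains f (c : qpath Q) : Prop :=
  exists (lam : K) (h : A),
    [/\ lam != 0, potential h, cyc_equiv f (lam *: monom c + h)
      & forall p, rotation_of c p -> h p = 0].

(* An isomorphism of algebras, identical on the scalars K = K *: 1. *)
Definition right_equivalence (phi : {rmorphism A -> A}) f g : Prop :=
  [/\ bijective phi, scalable phi, forall lam : K, phi (lam *: (1 : A)) = lam *: (1 : A)
    & cyc_equiv (phi f) g].

End CompletedPathAlgebra.

Arguments monom K {Q} p.

Section DoubleA.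
Variables (n : nat) (I : {set 'I_n}).

(* Vertices are numbered from 0. In Q_{n,I} there is at most one arrow from i
   to j, so arrows are encoded as pairs (tail, head). *)
Definition is_loop (p : 'I_n * 'I_n) : bool := (p.1 == p.2) && (p.1 \notin I).
Definition is_fwd (p : 'I_n * 'I_n) : bool := p.2 == p.1.+1 :> nat.
Definition is_bwd (p : 'I_n * 'I_n) : bool := p.1 == p.2.+1 :> nat.

Definition double_arrow := {p : 'I_n * 'I_n | [|| is_fwd p, is_bwd p | is_loop p]}.
HB.instance Definition _ := SubFinite.on double_arrow.

Definition double_quiver : quiver :=
  @Quiver 'I_n double_arrow (fun a => (val a).1) (fun a => (val a).2).

(* A member of the left-to-right list: (i, i) is the loop at i, and (i, i+1)
   is the pair of arrows between i and i+1. *)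
Definition slot := {p : 'I_n * 'I_n | is_fwd p || is_loop p}.
HB.instance Definition _ := SubFinite.on slot.

(* The left-to-right order is the lexicographic one. *)
Definition slots : seq slot :=
  pmap insub [seq (i, j) | i <- enum 'I_n, j <- enum 'I_n].

Definition nslots : nat := 2 * n - 1 - #|I|.

Lemma map_val_slots : map val slots =
  [seq p <- [seq (i, j) | i <- enum 'I_n, j <- enum 'I_n] | is_fwd p || is_loop p].
Proof.
rewrite /slots; elim: [seq _ | i <- _, j <- _] => //= p s IH.
by case: insubP => [u -> /= ->|/negPf ->] //=; rewrite IH.
Qed.

Lemma size_slots : size slots == nslots.
Proof.
rewrite -(size_map val) map_val_slots size_filter -sum1_count big_mkcond big_allpairs /=.
rewrite big_enum /=.
have E (i : 'I_n) : (\sum_(j <- enum 'I_n) (if is_fwd (i, j) || is_loop (i, j) then 1 else 0) =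
    (i.+1 < n) + (i \notin I))%N.
  rewrite big_enum /= -big_mkcond /=.
  rewrite (bigID (fun j => j == i)) /= addnC; congr (_ + _)%N.
    case: (ltnP i.+1 n) => lt.
      rewrite (bigD1 (Ordinal lt)) /=.
        rewrite big1 // => j /andP[/andP[]]; rewrite /is_fwd /is_loop /=.
        case/orP=> [/eqP e|/andP[/eqP <- _]]; last by rewrite eqxx.
        by move=> _ /eqP[]; apply: val_inj.
      by rewrite /is_fwd /is_loop /= eqxx; apply/eqP => /(congr1 val) /= /esym /n_Sn.
    apply: big1 => j /andP[]; rewrite /is_fwd /is_loop /= => /orP[/eqP e|].
      by have := ltn_ord j; rewrite e ltnNge lt.
    by case/andP => /eqP ->; rewrite eqxx.
  case: (boolP (i \in I)) => iI /=.
    apply: big1 => j /andP[]; rewrite /is_fwd /is_loop /= iI andbF orbF.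
    by move=> /eqP e /eqP ej; move: e; rewrite ej => /n_Sn.
  rewrite (bigD1 i) /=; last by rewrite /is_loop /= iI !eqxx orbT.
  by rewrite big1 // => j /andP[/andP[_ ->]].
rewrite (eq_bigr _ (fun i _ => E i)) big_split /=.
rewrite -(big_mkord xpredT (fun i => nat_of_bool (i.+1 < n)%N)) /=.
have -> : (\sum_(i < n) (i \notin I) = n - #|I|)%N.
  rewrite -{1}[n in RHS]card_ord -(cardsC I) addKn -sum1_card [RHS]big_mkcond.
  by apply: eq_bigr => i _; rewrite inE; case: (_ \in _).
have -> : (\sum_(0 <= i < n) (i.+1 < n) = n.-1)%N.
  case: n => [|k]; first by rewrite big_geq.
  rewrite big_nat_recr //= ltnn addn0 (eq_big_nat _ _ (F2 := fun=> 1%N)).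
    by rewrite sum_nat_const_nat subn0 muln1.
  by move=> i /andP[_ lt]; rewrite ltnS lt.
have := max_card (mem I); rewrite card_ord /nslots; move: #|I| => k le.
by apply/eqP; lia.
Qed.

(* The slots are numbered from left to right: consecutive ones meet at a
   vertex, so that the products x_k' x_(k+1) below do compose. *)
Lemma slots_sorted :
  sorted ltn [seq ((val c).1 + (val c).2)%N | c : slot <- slots].
Proof.
rewrite (map_comp (fun p : 'I_n * 'I_n => p.1 + p.2)%N val) map_val_slots.
rewrite (sorted_pairwise ltn_trans) pairwise_map.
pose lex (p q : 'I_n * 'I_n) := (p.1 < q.1)%N || (p.1 == q.1) && (p.2 < q.2)%N.
have L (s t : seq 'I_n) : pairwise (relpre val ltn) s -> pairwise (relpre val ltn) t ->
    pairwise lex [seq (i, j) | i <- s, j <- t].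
  move=> + ht; elim: s => [|i s IH] //= /andP[/allP hi hs].
  rewrite pairwise_cat IH // andbT; apply/andP; split; last first.
    rewrite pairwise_map; apply: sub_pairwise ht => x y /= h.
    by rewrite /lex /= eqxx h orbT.
  apply/allrelP => x y /mapP[j _ ->] /allpairsP[[i' j'] [/= /hi h _ ->]].
  by rewrite /lex /= [X in X || _]h.
have en : pairwise (relpre val ltn) (enum 'I_n).
  by rewrite -pairwise_map val_enum_ord -(sorted_pairwise ltn_trans) iota_ltn_sorted.
have := L _ _ en en; set l := [seq _ | i <- _, j <- _] => pl.
have := pairwise_filter (fun p => is_fwd p || is_loop p) pl.
apply: (sub_in_pairwise (P := fun p => is_fwd p || is_loop p)).
  move=> [p1 p2] [q1 q2]; rewrite /in_mem /lex /is_fwd /is_loop /= => hp hq.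
  have {}hp : (p1 <= p2 <= p1.+1)%N.
    by case/orP: hp => [/eqP ->|/andP[/eqP -> _]]; rewrite ?leqnn ?leqnSn.
  have {}hq : (q1 <= q2 <= q1.+1)%N.
    by case/orP: hq => [/eqP ->|/andP[/eqP -> _]]; rewrite ?leqnn ?leqnSn.
  by case/orP => [|/andP[/eqP ->]]; lia.
exact: filter_all.
Qed.

(* The k-th member of the list, numbered from 0. *)
Definition nth_slot (k : 'I_nslots) : slot := tnth (Tuple size_slots) k.

Lemma mem_slots (c : slot) : c \in slots.
Proof.
rewrite -(mem_map val_inj) map_val_slots mem_filter (valP c) /=.
by apply/allpairsP; exists (val c); split; rewrite ?mem_enum -?surjective_pairing.
Qed.

Lemma nth_slot_meet (i j : 'I_nslots) : j = i.+1 :> nat ->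
  (val (nth_slot i)).2 = (val (nth_slot j)).1.
Proof.
move=> eij; pose key (c : slot) := ((val c).1 + (val c).2)%N.
have srt (a b : 'I_nslots) : (key (nth_slot a) < key (nth_slot b))%N = (a < b)%N.
  have x0 := nth_slot a.
  have H (u v : 'I_nslots) : (u < v)%N -> (key (nth_slot u) < key (nth_slot v))%N.
    move=> uv; rewrite /nth_slot !(tnth_nth x0) /=.
    have S : sorted ltn (map key slots) := slots_sorted.
    have In (w : 'I_nslots) : nat_of_ord w \in gtn (size (map key slots)).
      by rewrite size_map (eqP size_slots); exact: ltn_ord.
    have := sorted_ltn_nth ltn_trans 0%N S _ _ (In u) (In v) uv.
    by rewrite !(nth_map x0) ?(eqP size_slots) ?ltn_ord.
  case: (ltngtP a b) => [/H|/H|/val_inj ->] //; last by rewrite ltnn.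
  by move=> h; apply/negbTE; rewrite -leqNgt ltnW.
have surj (c : slot) : exists k, nth_slot k = c.
  have lt : (index c slots < nslots)%N by rewrite -(eqP size_slots) index_mem mem_slots.
  by exists (Ordinal lt); rewrite /nth_slot (tnth_nth c) /= nth_index ?mem_slots.
have gap (c : slot) : (key (nth_slot i) < key c)%N -> (key c < key (nth_slot j))%N -> False.
  by case: (surj c) => k <-; rewrite !srt eij; lia.
have := srt i j; rewrite eij ltnSn.
move: gap (valP (nth_slot i)) (valP (nth_slot j)); rewrite /key.
move: (val (nth_slot i)) (val (nth_slot j)) => [p1 p2] [q1 q2] /= gap hp hq lt.
have P (k : nat) : (k.+1 < n)%N -> (p1 + p2 < k + k.+1)%N -> (q1 + q2 <= k + k.+1)%N.
  move=> kn l1; rewrite leqNgt; apply/negP => l2.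
  pose c := (Ordinal (ltnW kn), Ordinal kn).
  have hc : is_fwd c || is_loop c by rewrite /is_fwd /= eqxx.
  exact: (gap (exist _ c hc)).
apply: val_inj => /=.
have := ltn_ord q1; have := ltn_ord q2; have := ltn_ord p2.
have := P p1; have := P p2.
move: hp hq; rewrite /is_fwd /is_loop /=.
case/orP => [/eqP hp|/andP[/eqP /(congr1 val) /= hp _]];
  case/orP => [/eqP hq|/andP[/eqP /(congr1 val) /= hq _]]; lia.
Qed.

Lemma fwd_arrow_subproof (c : slot) :
  [|| is_fwd (val c), is_bwd (val c) | is_loop (val c)].
Proof. by case/orP: (valP c) => ->; rewrite ?orbT. Qed.

Lemma bwd_arrow_subproof (c : slot) :
  [|| is_fwd ((val c).2, (val c).1), is_bwd ((val c).2, (val c).1)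
    | is_loop ((val c).2, (val c).1)].
Proof.
case/orP: (valP c) => h; first by apply/or3P; apply: Or32.
by apply/or3P; apply: Or33; case/andP: h => /eqP e1; rewrite /is_loop /= e1 eqxx.
Qed.

Notation Qd := double_quiver.

Definition slot_a (c : slot) : qpath Qd :=
  @apath Qd (exist _ (val c) (fwd_arrow_subproof c)).
Definition slot_b (c : slot) : qpath Qd :=
  if is_loop (val c) then @vpath Qd (val c).1
  else @apath Qd (exist _ ((val c).2, (val c).1) (bwd_arrow_subproof c)).

Lemma target_slot_a c : ptarget (slot_a c) = (val c).2. Proof. by []. Qed.
Lemma source_slot_a c : psource (slot_a c) = (val c).1. Proof. by []. Qed.

Lemma target_slot_b c : ptarget (slot_b c) = (val c).1.
Proof. by rewrite /slot_b; case: ifP. Qed.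

Lemma source_slot_b c : psource (slot_b c) = (val c).2.
Proof. by rewrite /slot_b; case: ifP => // /andP[/eqP]. Qed.

Definition xpath (k : 'I_nslots) : qpath Qd :=
  pcomp (slot_a (nth_slot k)) (slot_b (nth_slot k)).
Definition xpath' (k : 'I_nslots) : qpath Qd :=
  pcomp (slot_b (nth_slot k)) (slot_a (nth_slot k)).

Lemma xpath_meet (i j : 'I_nslots) : j = i.+1 :> nat ->
  ptarget (xpath' i) = psource (xpath j).
Proof.
move=> e; rewrite ptarget_pcomp ?target_slot_b ?source_slot_a //.
rewrite psource_pcomp ?target_slot_a ?source_slot_b // source_slot_a.
exact: nth_slot_meet.
Qed.

Variable K : fieldType.
Implicit Types f : cpath_alg K Qd.

Lemma monom_xpath k :
  monom K (xpath k) = monom K (slot_a (nth_slot k)) * monom K (slot_b (nth_slot k)).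
Proof. by rewrite monomM target_slot_a source_slot_b eqxx. Qed.

Lemma monom_xpath' k :
  monom K (xpath' k) = monom K (slot_b (nth_slot k)) * monom K (slot_a (nth_slot k)).
Proof. by rewrite monomM target_slot_b source_slot_a eqxx. Qed.

Definition reduced_typeA f : Prop :=
  [/\ potential f, reduced f
    & forall i j : 'I_nslots, j = i.+1 :> nat ->
        contains f (pcomp (xpath' i) (xpath j))].

Definition monomialized_partial (kappa : 'I_nslots -> nat -> K) (N : nat)
    : cpath_alg K Qd :=
  \sum_(i < nslots) \sum_(j < nslots | j == i.+1 :> nat)
     monom K (xpath' i) * monom K (xpath j)
  + \sum_(i < nslots) \sum_(2 <= j < N) kappa i j *: monom K (xpath i) ^+ j.

Definition monomialized_typeA f : Prop :=
  potential f /\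
  exists (kappa : 'I_nslots -> nat -> K) (W : cpath_alg K Qd),
    adic_lim (monomialized_partial kappa) W /\ cyc_equiv f W.

End DoubleA.

(* Main.v *)
From HB Require Import structures.
From mathcomp Require Import all_boot all_order all_algebra.
From mathcomp Require Import boolp reals complex zify ring.
Require Import Defs.

(** Every slot contributes the cycles [x_i = A_i B_i] and [x_i' = B_i A_i], where
    [B_i] is the loop, or the arrow pointing left; [A_i] is trivial for a loop.
    Right-equivalences are built as substitutions of the [B_i] alone, and words
    are removed from the potential in order of increasing weight.

    Two facts make this work. First, a cyclic word that is not a power of some
    [x_i] can be rotated into [A_i x_(i+1) p] with [p] parallel to [B_i]
    ([cyclic_shapeP]): when the walk enters its rightmost slot from further left,
    it can only go there and back.
    Second, replacing [B_i] by [B_i - mu p] turns [x_i' x_(i+1)] into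
    [x_i' x_(i+1) - mu p A_i x_(i+1)], which cancels a rotation of this word, and it changes
    the remaining terms in harmless positions only, provided that weights are
    chosen well: [x_i] is given a weight that decreases slowly with [i], so that
    among the quadratic terms containing [B_i], which are [x_(i-1)' x_i],
    [x_i^2] and [x_i' x_(i+1)], the last one is strictly the lightest.
    Hence all the words of one weight [N], other than powers of the [x_i], are
    removed at the cost of terms of weight above [N] ([kill_level]).

    The induction starts from words heavier than the quadratic ones. The
    quadratic part of a reduced Type A potential consists of the
    [x_i' x_(i+1)], whose coefficients are nonzero (they are detected by a trace
    functional that vanishes on commutators, [contains_trace]), of squares, and
    of words [x_(i-1)' x_(i+1)] stepping over a loop [x_i]. Rescaling the [B_i]
    makes the coefficients of the [x_i' x_(i+1)] equal to 1, and replacing the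
    loop [x_i] by [x_i - mu x_(i-1)'] trades the words of the last kind for
    squares ([normalize]).

    The arrows move by terms of growing weight in the successive substitutions,
    so their images converge. The limit is again a substitution, it is unipotent
    and hence bijective ([sub_bij]), and cyclic equivalence passes to the limit
    because it is defined by a closed subspace ([monomialize]). *)

Set Implicit Arguments.
Unset Strict Implicit.
Unset Printing Implicit Defensive.

Import GRing.Theory.
Local Open Scope ring_scope.

(** * Formal combinations of paths and their filtrations *)

Lemma mulB_split (R : pzRingType) (x x' y y' : R) :
  x * y - x' * y' = (x - x') * y + x' * (y - y').
Proof. by rewrite mulrBl mulrBr addrA subrK. Qed.

Section Coefficients.
Variables (K : fieldType) (Q : quiver).
Notation A := (cpath_alg K Q).
Implicit Types (f g h : A) (p q : qpath Q).

Lemma coef_zero p : (0 : A) p = 0. Proof. by []. Qed.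
Lemma coef_add f g p : (f + g) p = f p + g p. Proof. by []. Qed.
Lemma coef_opp f p : (- f) p = - f p. Proof. by []. Qed.
Lemma coef_scale (c : K) f p : (c *: f) p = c * f p. Proof. by []. Qed.
Lemma coef_one p : (1 : A) p = (plen p == 0%N)%:R. Proof. by []. Qed.
Lemma coef_mul f g p :
  (f * g) p = \sum_(0 <= i < (plen p).+1) f (ptake i p) * g (pdrop i p).
Proof. by []. Qed.
Lemma coef_bigsum (J : Type) (r : seq J) (P : pred J) (F : J -> A) p :
  (\sum_(i <- r | P i) F i) p = \sum_(i <- r | P i) F i p.
Proof. by elim/big_rec2: _ => // i x y _ <-. Qed.
Definition coef_lin := (coef_add, coef_opp, coef_scale, coef_zero).

Lemma scaleAl (c : K) f g : c *: (f * g) = (c *: f) * g.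
Proof. exact: cpa_scaleAl. Qed.
Lemma scaleAr (c : K) f g : c *: (f * g) = f * (c *: g).
Proof. exact: cpa_scaleAr. Qed.

(** Unlike [monom], [mon v s] makes sense for every sequence of arrows, being
    zero when they do not compose from [v]; so products of paths are
    concatenations without proofs of composability. *)
Fact mon_key : unit. Proof. exact: tt. Qed.
Definition mon : vertex Q -> seq (arrow Q) -> A :=
  locked_with mon_key (fun v s => CPathAlg (fun p => (val p == (v, s))%:R)).

Lemma coef_mon v s p : mon v s p = (val p == (v, s))%:R.
Proof. by rewrite /mon unlock. Qed.

Lemma monE p : monom K p = mon (psource p) (parrows p).
Proof.
apply: cpath_algP => q; rewrite coef_mon /=.
by rewrite -val_eqE /psource /parrows -surjective_pairing.
Qed.

Lemma parrows_pcomp p q : ptarget p = psource q ->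
  parrows (pcomp p q) = parrows p ++ parrows q.
Proof. by move=> e; rewrite /parrows [val (pcomp p q)]val_pcomp. Qed.

Lemma mon_exist v s (cs : composable v s) : mon v s = monom K (exist _ (v, s) cs).
Proof. by rewrite monE. Qed.

Lemma mon0 v s : ~~ composable v s -> mon v s = 0.
Proof.
move=> nc; apply: cpath_algP => p; rewrite coef_mon.
by case: eqP => // e; case/negP: nc; have := svalP p; rewrite e.
Qed.

Lemma mon_cat v s t : mon v (s ++ t) = mon v s * mon (endpoint v s) t.
Proof.
have := composable_cat v s t.
case: (boolP (composable v s)) => cs /=; last first.
  by move/negbT => h; rewrite (mon0 h) (mon0 cs) mul0r.
case: (boolP (composable _ t)) => ct /=; last first.
  by move/negbT => h; rewrite (mon0 h) (mon0 ct) mulr0.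
move=> h; rewrite (mon_exist cs) (mon_exist ct) monomM /= eqxx.
rewrite (mon_exist h); congr monom; apply: val_inj; rewrite val_pcomp //.
Qed.

Lemma mon_mul_ne v s w t : endpoint v s != w -> mon v s * mon w t = 0.
Proof.
move=> ne.
case: (boolP (composable v s)) => cs; last by rewrite (mon0 cs) mul0r.
case: (boolP (composable w t)) => ct; last by rewrite (mon0 ct) mulr0.
by rewrite (mon_exist cs) (mon_exist ct) monomM ifN.
Qed.

Lemma mon_mul v s w t :
  mon v s * mon w t = if endpoint v s == w then mon v (s ++ t) else 0.
Proof. by case: eqP => [<-|/eqP/mon_mul_ne->//]; rewrite mon_cat. Qed.

Lemma one_sum : (1 : A) = \sum_(v : vertex Q) mon v [::].
Proof.
apply: cpath_algP => p; rewrite coef_bigsum coef_one (bigD1 (psource p)) //= coef_mon.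
rewrite big1 => [|v ne].
  rewrite addr0 /plen size_eq0; congr (nat_of_bool _)%:R.
  by case: p => [[v s] c]; rewrite /parrows /psource /= xpair_eqE eqxx.
rewrite coef_mon; case: eqP => // e; case/eqP: ne.
by rewrite /psource [val p]e.
Qed.

End Coefficients.

Arguments mon {K Q}.

Section Filtration.
Variables (K : fieldType) (Q : quiver).
Notation A := (cpath_alg K Q).
Implicit Types (f g h : A) (p q : qpath Q) (w : arrow Q -> nat).

Definition wts w (s : seq (arrow Q)) : nat := sumn (map w s).
Definition wt w p : nat := wts w (parrows p).

(** The powers of the arrow ideal when the arrow [a] counts for [w a]: constant
    weight 1 gives the adic filtration, and every positive weight on the finitely
    many arrows defines the same topology. *)
Definition filt w N f : Prop := forall p, (wt w p < N)%N -> f p = 0.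

Lemma wts_cat w s t : wts w (s ++ t) = (wts w s + wts w t)%N.
Proof. by rewrite /wts map_cat sumn_cat. Qed.

Lemma wt_cut w i p : wt w p = (wt w (ptake i p) + wt w (pdrop i p))%N.
Proof. by rewrite /wt -wts_cat /= cat_take_drop. Qed.

Lemma wts_size w s : (forall a, 0 < w a)%N -> (size s <= wts w s)%N.
Proof. by move=> pos; elim: s => //= a s IH; have := pos a; rewrite /wts /= -/(wts w s); lia. Qed.

Lemma wts1 s : wts (fun=> 1%N) s = size s.
Proof. by elim: s => //= a s <-. Qed.

Lemma wt1 p : wt (fun=> 1%N) p = plen p. Proof. exact: wts1. Qed.

Lemma in_adicE N f : in_adic N f <-> filt (fun=> 1%N) N f.
Proof. by split=> h p; have := h p; rewrite wt1. Qed.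

Lemma filt_le w M N f : (N <= M)%N -> filt w M f -> filt w N f.
Proof. by move=> le h p lt; apply: h; apply: leq_trans le. Qed.

Lemma filt0 w f : filt w 0 f. Proof. by []. Qed.
Lemma filt_0 w N : filt w N (0 : A). Proof. by []. Qed.
Lemma filtD w N f g : filt w N f -> filt w N g -> filt w N (f + g).
Proof. by move=> hf hg p lt; rewrite coef_add hf // hg // addr0. Qed.
Lemma filtN w N f : filt w N f -> filt w N (- f).
Proof. by move=> hf p lt; rewrite coef_opp hf // oppr0. Qed.
Lemma filtB w N f g : filt w N f -> filt w N g -> filt w N (f - g).
Proof. by move=> hf hg; apply: filtD => //; apply: filtN. Qed.
Lemma filtZ w N c f : filt w N f -> filt w N (c *: f).
Proof. by move=> hf p lt; rewrite coef_scale hf // mulr0. Qed.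
Lemma filt_sum w N (J : Type) (r : seq J) (P : pred J) (F : J -> A) :
  (forall i, P i -> filt w N (F i)) -> filt w N (\sum_(i <- r | P i) F i).
Proof. by move=> h; elim/big_ind: _ => //; apply: filtD. Qed.

Lemma filtM w M N L f g : (L <= M + N)%N ->
  filt w M f -> filt w N g -> filt w L (f * g).
Proof.
move=> le hf hg p lt; rewrite coef_mul big1 // => i _.
have := wt_cut w i p => e.
case: (ltnP (wt w (ptake i p)) M) => c; first by rewrite hf ?mul0r.
by rewrite hg ?mulr0 //; lia.
Qed.

Lemma filtMl w N f g : filt w N f -> filt w N (f * g).
Proof. by move=> h; apply: (@filtM w N 0) => //; rewrite addn0. Qed.
Lemma filtMr w N f g : filt w N g -> filt w N (f * g).
Proof. by move=> h; apply: (@filtM w 0 N). Qed.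

Lemma filt_mon w N v s : (N <= wts w s)%N -> filt w N (mon v s : A).
Proof.
move=> le p lt; rewrite coef_mon; case: eqP => // e; move: lt.
by rewrite /wt /parrows [val p]e /= ltnNge le.
Qed.

Lemma filtX w N n f : filt w N f -> filt w (n * N) (f ^+ n).
Proof.
move=> h; elim: n => [|n IH]; first by rewrite mul0n.
by rewrite exprS; apply: (filtM _ h IH); rewrite mulSn.
Qed.

Lemma filt_adic w b N f : (forall a, w a <= b)%N ->
  filt w (N * b).+1 f -> in_adic N f.
Proof.
move=> hb hf p lt; apply: hf; rewrite ltnS.
have : (wt w p <= plen p * b)%N.
  rewrite /wt /plen; elim: (parrows p) => //= a s IH.
  by rewrite /wts /= -/(wts w s) mulSn leq_add.
by move/leq_trans; apply; rewrite leq_mul2r ltnW ?orbT.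
Qed.

Lemma filt_eq0 w f : (forall N, filt w N f) -> f = 0.
Proof. by move=> h; apply: cpath_algP => p; apply: (h (wt w p).+1). Qed.

Lemma filt_cauchy w c (u : nat -> A) : (forall k, filt w (c + k) (u k.+1 - u k)) ->
  forall k l, (k <= l)%N -> filt w (c + k) (u l - u k).
Proof.
move=> h k l /subnK <-; elim: (l - k)%N => [|d IH]; first by rewrite subrr.
rewrite addSn -(subrK (u (d + k)%N) (u _)) -addrA; apply: filtD => //.
by apply: filt_le (h _); rewrite leq_add2l leq_addl.
Qed.

(** The coefficient at [p] of a sequence whose [k]-th increment has order [k] is
    constant from the index [wt w p + 1] on, and can be read off there. *)
Definition flim w (u : nat -> A) : A := CPathAlg (fun p => u (wt w p).+1 p).

Lemma flimP w c (u : nat -> A) : (forall k, filt w (c + k) (u k.+1 - u k)) ->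
  forall k, filt w (c + k) (flim w u - u k).
Proof.
move=> h k p lt; rewrite !coef_lin /=.
case: (leqP k (wt w p).+1) => le.
  by have := filt_cauchy h le lt; rewrite !coef_lin.
have := filt_cauchy h (ltnW le) (p := p); rewrite !coef_lin => h'.
by rewrite -[X in X = 0]opprK opprB h' ?oppr0 //; lia.
Qed.

End Filtration.

Arguments flimP {K Q w c u}.

Section Truncation.
Variables (K : fieldType) (Q : quiver).
Notation A := (cpath_alg K Q).
Implicit Types (f g h : A) (p q : qpath Q) (w : arrow Q -> nat).

Definition paths_upto N : seq (qpath Q) :=
  pmap insub [seq (v, bseqval s) | v <- enum (vertex Q), s <- enum {bseq N of arrow Q}].

Lemma mem_paths_upto N p : (p \in paths_upto N) = (plen p <= N)%N.
Proof.
rewrite mem_pmap_sub; apply/allpairsP/idP => [[[v s] /= [_ _ e]]|le].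
  by rewrite /plen /parrows [val p]e size_bseq.
exists (psource p, Bseq le); split; rewrite ?mem_enum //=.
by rewrite /psource /parrows -surjective_pairing.
Qed.

Lemma paths_upto_uniq N : uniq (paths_upto N).
Proof.
apply: pmap_sub_uniq; apply: allpairs_uniq; rewrite ?enum_uniq //.
by move=> [v s] [v' s'] _ _ /= [-> /val_inj ->].
Qed.

Lemma sum_monom (P : pred (qpath Q)) N f p :
  (\sum_(q <- paths_upto N | P q) f q *: monom K q) p =
  if P p && (plen p <= N)%N then f p else 0.
Proof.
rewrite coef_bigsum; case: ifP => [/andP[Pp le]|no].
  rewrite -big_filter (bigD1_seq p) ?filter_uniq ?paths_upto_uniq //=; last first.
    by rewrite mem_filter Pp mem_paths_upto.
  rewrite eqxx mulr1 big1 ?addr0 // => q ne.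
  by rewrite eq_sym (negbTE ne) mulr0.
rewrite big_seq_cond big1 // => q /andP[]; rewrite mem_paths_upto => le Pq.
by rewrite coef_scale /=; case: eqP => [e|]; rewrite ?mulr0 //; rewrite e Pq le in no.
Qed.

Definition trunc N f : A := \sum_(q <- paths_upto N) f q *: monom K q.

Lemma coef_trunc N f p : trunc N f p = if (plen p <= N)%N then f p else 0.
Proof. by rewrite /trunc (@sum_monom xpredT). Qed.

Lemma truncP N f : in_adic N.+1 (f - trunc N f).
Proof. by move=> p lt; rewrite !coef_lin coef_trunc -ltnS lt subrr. Qed.

End Truncation.

(** * Substitutions of the arrows *)

Section Substitutions.
Variables (K : fieldType) (Q : quiver).
Notation A := (cpath_alg K Q).
Implicit Types (f g h : A) (p q : qpath Q) (w : arrow Q -> nat).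
Implicit Types (a : arrow Q) (v : vertex Q) (s : seq (arrow Q)).

Lemma coef_idl v f p : (mon v [::] * f) p = if psource p == v then f p else 0.
Proof.
rewrite coef_mul big_nat_recl //= coef_mon pdrop0 big1_seq ?addr0.
  rewrite xpair_eqE take0 eqxx andbT; case: ifP => _; rewrite ?mul1r ?mul0r //.
move=> i /andP[_]; rewrite mem_index_iota => /andP[_ lt].
rewrite coef_mon xpair_eqE [X in _ && X](_ : _ = false) ?andbF ?mul0r //.
by apply/negP => /eqP /(congr1 size); rewrite size_takel.
Qed.

Lemma coef_idr v f p : (f * mon v [::]) p = if ptarget p == v then f p else 0.
Proof.
rewrite coef_mul big_nat_recr //= coef_mon ptake_plen big1_seq ?add0r.
  rewrite xpair_eqE /plen drop_size take_size eqxx andbT.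
  by rewrite /ptarget; case: ifP => _; rewrite ?mulr1 ?mulr0.
move=> i /andP[_]; rewrite mem_index_iota => /andP[_ lt].
rewrite coef_mon xpair_eqE [X in _ && X](_ : _ = false) ?andbF ?mulr0 //.
by apply/negP => /eqP /(congr1 size); rewrite size_drop /=; move: lt; rewrite /plen; lia.
Qed.

Definition parallel v v' f :=
  forall p, f p != 0 -> [/\ psource p = v, ptarget p = v' & (0 < plen p)%N].

Lemma parallel_idl v v' f : parallel v v' f -> mon v [::] * f = f.
Proof.
move=> h; apply: cpath_algP => p; rewrite coef_idl; case: eqP => // ne.
by apply/esym/eqP; apply: contraT => /h[].
Qed.

Lemma parallel_idr v v' f : parallel v v' f -> f * mon v' [::] = f.
Proof.
move=> h; apply: cpath_algP => p; rewrite coef_idr; case: eqP => // ne.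
by apply/esym/eqP; apply: contraT => /h[].
Qed.

Lemma parallelD v v' f g : parallel v v' f -> parallel v v' g -> parallel v v' (f + g).
Proof.
move=> hf hg p; rewrite coef_add => ne.
by case: (f p =P 0) ne => [->|/eqP/hf //]; rewrite add0r => /hg.
Qed.

Lemma parallelZ v v' c f : parallel v v' f -> parallel v v' (c *: f).
Proof. by move=> hf p; rewrite coef_scale mulf_eq0 negb_or => /andP[_ /hf]. Qed.

Lemma parallelN v v' f : parallel v v' f -> parallel v v' (- f).
Proof. by move=> hf p; rewrite coef_opp oppr_eq0 => /hf. Qed.

Lemma parallel0 v v' : parallel v v' (0 : A).
Proof. by move=> p; rewrite coef_zero eqxx. Qed.

Lemma parallel_mon v v' s :
  endpoint v s = v' -> (0 < size s)%N -> parallel v v' (mon v s : A).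
Proof.
move=> e sz p; rewrite coef_mon; case: (val p =P (v, s)) => [E _|_]; last by rewrite eqxx.
by rewrite /psource /ptarget /plen /psource /parrows [val p]E.
Qed.

(** The image of an arrow has the same ends, so that products of images follow
    the composition of arrows, and has no constant term, so that the substitution
    of an infinite combination of paths converges. *)
Record substitution := Substitution {
  simg :> arrow Q -> A;
  simgP : forall a, parallel (qtail a) (qhead a) (simg a)
}.
Arguments simgP : clear implicits.
Implicit Types th et : substitution.

(** The image of the path [s] from [v]; the idempotent in front matters when [s]
    is empty. *)
Definition star th v s : A := mon v [::] * \prod_(a <- s) th a.

Lemma star_cons th a s : star th (qtail a) (a :: s) = th a * star th (qhead a) s.
Proof.
rewrite /star big_cons mulrA (parallel_idl (simgP th a)).
by rewrite mulrA (parallel_idr (simgP th a)).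
Qed.

Lemma star_nil th v : star th v [::] = mon v [::].
Proof. by rewrite /star big_nil mulr1. Qed.

Lemma star_cat th v s t : composable v s ->
  star th v (s ++ t) = star th v s * star th (endpoint v s) t.
Proof.
elim: s v => [|a s IH] v /=.
  by rewrite star_nil /star mulrA mon_mul eqxx.
by case/andP=> /eqP <- /IH e; rewrite !star_cons e mulrA.
Qed.

Lemma star_end th v s : composable v s ->
  star th v s = star th v s * mon (endpoint v s) [::].
Proof. by move=> c; rewrite -{1}[s]cats0 star_cat // star_nil. Qed.

Definition bounded w th := forall a, filt w (w a) (th a).

Lemma bounded1 th : bounded (fun=> 1%N) th.
Proof.
move=> a p; rewrite wt1 => lt; apply/eqP; apply: contraT => /simgP[_ _].
by case: (plen p) lt.
Qed.

Lemma star_filt w th v s : bounded w th -> filt w (wts w s) (star th v s).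
Proof.
move=> b; apply: filtMr; elim: s => [|a s IH]; first exact: filt0.
by rewrite big_cons; apply: (filtM _ (b a) IH).
Qed.

Lemma star_close w d th et v s : bounded w th -> bounded w et ->
  (forall a, filt w (w a + d) (th a - et a)) ->
  filt w (wts w s + d) (star th v s - star et v s).
Proof.
move=> bt be h; rewrite /star -mulrBr; apply: filtMr.
elim: s => [|a s IH]; first by rewrite !big_nil subrr.
have F x : filt w (wts w x) (\prod_(b <- x) th b).
  elim: x => [|c x IHx]; first exact: filt0.
  by rewrite big_cons; apply: (filtM _ (bt c) IHx).
rewrite !big_cons mulB_split; apply: filtD.
  by apply: (filtM _ (h a) (F s)); rewrite /wts /= -!/(wts w _); lia.
by apply: (filtM _ (be a) IH); rewrite /wts /= -!/(wts w _); lia.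
Qed.

Notation pstar th q := (star th (psource q) (parrows q)).

Definition sub th f : A :=
  CPathAlg (fun p => \sum_(q <- paths_upto Q (plen p)) f q * pstar th q p).

Lemma coef_subE th f p :
  sub th f p = \sum_(q <- paths_upto Q (plen p)) f q * pstar th q p.
Proof. by []. Qed.

(** Images have no constant term, so only finitely many paths contribute to a
    given coefficient of a substituted series. *)
Lemma star_short th q p : (plen p < plen q)%N -> pstar th q p = 0.
Proof.
move=> lt; have := @star_filt _ _ (psource q) (parrows q) (@bounded1 th) p.
by rewrite wts1 wt1; apply.
Qed.

Lemma coef_sub N th f p : (plen p <= N)%N ->
  sub th f p = \sum_(q <- paths_upto Q N) f q * pstar th q p.
Proof.
move=> le; rewrite coef_subE.
rewrite [RHS](bigID (fun q => (plen q <= plen p)%N)) -[RHS]/(_ + _).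
rewrite [X in _ + X]big1 ?addr0; last first.
  by move=> q; rewrite -ltnNge => /(star_short th) ->; rewrite mulr0.
rewrite -[RHS]big_filter; apply: perm_big; apply: uniq_perm.
- exact: paths_upto_uniq.
- by rewrite filter_uniq // paths_upto_uniq.
by move=> q; rewrite mem_filter !mem_paths_upto; case: leqP => // l; rewrite (leq_trans l).
Qed.

Lemma sub_linear th : linear (sub th).
Proof.
move=> c f g; apply: cpath_algP => p; rewrite coef_add coef_scale !coef_subE big_distrr -big_split.
by apply: eq_bigr => q _; rewrite coef_add coef_scale mulrDl -mulrA.
Qed.
HB.instance Definition _ th := GRing.isLinear.Build K A A *:%R (sub th) (@sub_linear th).

Lemma sub_monom th q : sub th (monom K q) = pstar th q.
Proof.
apply: cpath_algP => p; rewrite (coef_sub (N := maxn (plen p) (plen q)) _ _ (leq_maxl (plen p) (plen q))).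
rewrite (bigD1_seq q) ?mem_paths_upto ?paths_upto_uniq ?leq_maxr //.
have M r : monom K q r = (r == q)%:R by [].
by rewrite M eqxx mul1r big1 => [|r /negbTE ne]; [apply: addr0|rewrite M ne mul0r].
Qed.

Lemma sub_mon th v s : composable v s -> sub th (mon v s) = star th v s.
Proof. by move=> c; rewrite (mon_exist _ c) sub_monom. Qed.

Lemma sub_filt w th N f : bounded w th -> filt w N f -> filt w N (sub th f).
Proof.
move=> b hf p lt; apply: big1 => q _.
case: (ltnP (wt w q) N) => c; first by rewrite hf // mul0r.
by rewrite (@star_filt w th _ _ b) ?mulr0 //; apply: leq_trans c.
Qed.

(** A product of arrow images telescopes, and each difference between an image
    under [th] and one under [et] lies [d] deeper than the arrow it stands for. *)
Lemma sub_close w d N th et f : bounded w th -> bounded w et ->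
  (forall a, filt w (w a + d) (th a - et a)) -> filt w N f ->
  filt w (N + d) (sub th f - sub et f).
Proof.
move=> bt be h hf p lt; rewrite coef_add coef_opp !coef_subE -sumrB big1 // => q _.
case: (ltnP (wt w q) N) => c; first by rewrite hf // !mul0r subrr.
have := @star_close _ _ _ _ (psource q) (parrows q) bt be h p.
rewrite !coef_lin -mulrBr => -> //; rewrite ?mulr0 //.
by apply: leq_trans lt _; rewrite leq_add2r.
Qed.

Lemma eq_in_adic f g : (forall N, in_adic N (f - g)) -> f = g.
Proof.
move=> h; apply: cpath_algP => p; apply/eqP; rewrite -subr_eq0.
by have := h (plen p).+1 p (ltnSn _); rewrite !coef_lin => ->.
Qed.

Lemma sub_adic th N f : in_adic N f -> in_adic N (sub th f).
Proof. by rewrite !in_adicE; apply: sub_filt; apply: bounded1. Qed.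

Lemma adicD N f g : in_adic N f -> in_adic N g -> in_adic N (f + g).
Proof. by rewrite !in_adicE; apply: filtD. Qed.
Lemma adicB N f g : in_adic N f -> in_adic N g -> in_adic N (f - g).
Proof. by rewrite !in_adicE; apply: filtB. Qed.
Lemma adicMl N f g : in_adic N f -> in_adic N (f * g).
Proof. by rewrite !in_adicE; apply: filtMl. Qed.
Lemma adicMr N f g : in_adic N g -> in_adic N (f * g).
Proof. by rewrite !in_adicE; apply: filtMr. Qed.

Lemma truncM N f g : in_adic N.+1 (f * g - trunc N f * trunc N g).
Proof.
by rewrite mulB_split; apply: adicD; [apply: adicMl|apply: adicMr]; apply: truncP.
Qed.

Lemma star_pcomp th p q : ptarget p = psource q ->
  pstar th (pcomp p q) = pstar th p * pstar th q.
Proof.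
move=> e; rewrite -e -star_cat ?(svalP p) //.
by rewrite psource_pcomp // parrows_pcomp.
Qed.

Lemma sub_monomM th p q :
  sub th (monom K p * monom K q) = sub th (monom K p) * sub th (monom K q).
Proof.
rewrite monomM !sub_monom; case: eqP => [e|/eqP ne]; first by rewrite sub_monom star_pcomp.
rewrite linear0 star_end ?(svalP p) // /(star th (psource q)) -mulrA [X in _ * X]mulrA.
by rewrite mon_mul_ne ?mul0r ?mulr0.
Qed.

(** By continuity it is enough to compare the two sides on truncations, hence on
    products of two paths. *)
Lemma sub_mulM th : monoid_morphism (sub th).
Proof.
split.
  rewrite one_sum linear_sum; apply: eq_bigr => v _.
  by rewrite -[LHS]/(sub th _) sub_mon // star_nil.
move=> f g; apply: eq_in_adic => -[|N]; first by move=> p; rewrite ltn0.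
have T h := @truncP K Q N h; have TS h := sub_adic th (T h).
rewrite -(subrK (sub th (trunc N f * trunc N g)) (sub th (f * g))) -linearB -addrA.
apply: adicD; first by apply/sub_adic/truncM.
rewrite -(subrK (sub th (trunc N f) * sub th (trunc N g)) (sub th (_ * _))) -addrA.
apply: adicD; last first.
  rewrite -opprB; have -> : forall x y : A, - (x - y) = (0 - (x - y)) by move=> x y; rewrite sub0r.
  apply: adicB => //.
  by rewrite mulB_split -!linearB; apply: adicD; [apply: adicMl|apply: adicMr]; apply: TS.
set x := _ - _; suff -> : x = 0 by [].
apply/eqP; rewrite subr_eq0 /trunc mulr_suml !linear_sum mulr_suml; apply/eqP.
apply: eq_bigr => p _; rewrite !mulr_sumr linear_sum; apply: eq_bigr => q _.
by rewrite -!(scaleAl, scaleAr) !linearZ /= -!(scaleAl, scaleAr) sub_monomM.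
Qed.
HB.instance Definition _ th := GRing.isMonoidMorphism.Build A A (sub th) (sub_mulM th).

Lemma sub_mul th f g : sub th (f * g) = sub th f * sub th g.
Proof. exact: rmorphM. Qed.
Lemma subD th f g : sub th (f + g) = sub th f + sub th g.
Proof. exact: linearD. Qed.
Lemma subB th f g : sub th (f - g) = sub th f - sub th g.
Proof. exact: linearB. Qed.
Lemma subZ th c f : sub th (c *: f) = c *: sub th f.
Proof. exact: linearZ. Qed.
Lemma sub_sum th (J : Type) (r : seq J) (P : pred J) (F : J -> A) :
  sub th (\sum_(i <- r | P i) F i) = \sum_(i <- r | P i) sub th (F i).
Proof. exact: linear_sum. Qed.
Lemma sub_exp th f n : sub th (f ^+ n) = sub th f ^+ n.
Proof. exact: rmorphXn. Qed.
Lemma sub_idem th v : sub th (mon v [::]) = mon v [::].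
Proof. by rewrite sub_mon // star_nil. Qed.

Lemma sub_prod th et v s : composable v s -> sub et (star th v s) =
  mon v [::] * \prod_(a <- s) sub et (th a).
Proof.
move=> c; rewrite /star rmorphM rmorph_prod; congr (_ * _).
by rewrite -[LHS]/(sub et _) sub_mon // star_nil.
Qed.

Lemma sub_parallel th v v' f : parallel v v' f -> parallel v v' (sub th f).
Proof.
move=> h p.
have l := parallel_idl h; have r := parallel_idr h.
rewrite -l sub_mul sub_idem coef_idl; case: (psource p =P v) => [->|_]; last by rewrite eqxx.
rewrite -r sub_mul sub_idem coef_idr; case: (ptarget p =P v') => [->|_]; last by rewrite eqxx.
move=> ne; split=> //; have : filt (fun=> 1%N) 1 (sub th f).
  apply: sub_filt; first exact: bounded1.
  move=> q; rewrite wt1 => lt; apply/eqP; apply: contraT => /h[_ _].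
  by case: (plen q) lt.
by move/(_ p); rewrite wt1; case: (plen p) => // /(_ isT) e; rewrite e eqxx in ne.
Qed.

Definition scomp et th : substitution :=
  Substitution (fun a => sub_parallel (th := et) (simgP th a)).

Lemma sub_scomp et th f : sub (scomp et th) f = sub et (sub th f).
Proof.
apply: eq_in_adic => -[|N]; first by move=> p; rewrite ltn0.
have := @truncP K Q N f; set T := trunc N f => hT.
rewrite -(subrK T f) !subD opprD addrACA.
apply: adicD; first by rewrite -!subD; apply: adicB; do ?apply: sub_adic.
rewrite [X in in_adic _ X](_ : _ = 0) //; apply/eqP; rewrite subr_eq0 /T /trunc !sub_sum.
apply/eqP; apply: eq_bigr => p _; rewrite !subZ !sub_monom.
by rewrite sub_prod ?(svalP p).
Qed.

Definition sid : substitution :=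
  Substitution (fun a => parallel_mon (v := qtail a) (s := [:: a]) erefl isT).

Lemma sub_sid f : sub sid f = f.
Proof.
have S v s : composable v s -> star sid v s = mon v s.
  elim: s v => [|a s IH] v /=; first by rewrite star_nil.
  case/andP=> /eqP <- c; rewrite star_cons IH //= mon_mul eqxx //.
apply: cpath_algP => p; rewrite coef_subE.
have e : (\sum_(q <- paths_upto Q (plen p)) f q *: monom K q) p = f p.
  by rewrite (@sum_monom K Q xpredT) leqnn.
rewrite -[RHS]e coef_bigsum.
by apply: eq_bigr => q _; rewrite S ?(svalP q) // -monE.
Qed.

Lemma bounded_sid w : bounded w sid.
Proof. by move=> a; apply: filt_mon; rewrite /wts /= addn0. Qed.

Definition unipotent w d th := forall a, filt w (w a + d) (th a - sid a).

Lemma unipotent_bounded w d th : unipotent w d th -> bounded w th.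
Proof.
move=> u a; rewrite -(subrK (sid a) (th a)); apply: filtD; last exact: bounded_sid.
by apply: filt_le (u a); apply: leq_addr.
Qed.

Lemma sub_unipotent w d N th f : unipotent w d th -> filt w N f ->
  filt w (N + d) (sub th f - f).
Proof.
move=> u hf; rewrite -[X in _ - X]sub_sid.
by apply: sub_close => //; [apply: unipotent_bounded u|apply: bounded_sid].
Qed.

(** The operator is [1 + T] with [T] strictly raising the filtration: its kernel
    lies in every step of it, and a preimage of [g] is the limit of the iteration
    [x <- g - T x]. *)
Lemma sub_bij w th : unipotent w 1 th -> bijective (sub th).
Proof.
move=> u; have T N f : filt w N f -> filt w N.+1 (sub th f - f).
  by move=> h; rewrite -addn1; apply: sub_unipotent.
have inj : injective (sub th).
  move=> f g /eqP; rewrite -subr_eq0 -linearB => /eqP e.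
  apply/eqP; rewrite -subr_eq0; apply/eqP; apply: (@filt_eq0 _ _ w).
  elim=> // N /T; rewrite e sub0r => /filtN; by rewrite opprK.
have surj g : exists f, sub th f = g.
  pose S f := g - (sub th f - f); pose u_ k := iter k S 0.
  have C k : filt w (0 + k) (u_ k.+1 - u_ k).
    rewrite add0n; elim: k => // k /T; rewrite linearB /= => IH.
    have -> : u_ k.+2 - u_ k.+1 = - (sub th (u_ k.+1) - sub th (u_ k) - (u_ k.+1 - u_ k)).
      rewrite [u_ k.+2]/(S _) [X in _ - X]/(S (u_ k)) /S.
      by apply: cpath_algP => p; rewrite !coef_lin; ring.
    exact: filtN.
  exists (flim w u_); apply/eqP; rewrite -subr_eq0; apply/eqP; apply: (@filt_eq0 _ _ w) => N.
  have L := flimP C N; have L1 := flimP C N.+1; rewrite !add0n in L L1.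
  have := T _ _ L; rewrite linearB /= => L2.
  have -> : sub th (flim w u_) - g =
     (sub th (flim w u_) - sub th (u_ N) - (flim w u_ - u_ N)) + (flim w u_ - u_ N.+1).
    by rewrite [u_ N.+1]/(S (u_ N)) /S; apply: cpath_algP => p; rewrite !coef_lin; ring.
  by apply: filtD; [apply: filt_le L2|apply: filt_le L1].
pose inv g := sval (cid (surj g)).
have K1 : cancel inv (sub th) by move=> g; apply: (svalP (cid (surj g))).
by exists inv => // f; apply: inj; rewrite K1.
Qed.

Lemma sub_potential th f : potential f -> potential (sub th f).
Proof.
move=> pf p ne.
have [q [fq sq]] : exists q, f q != 0 /\ pstar th q p != 0.
  apply: contrapT => no; case/eqP: ne; apply: big1 => q _.
  by apply/eqP; rewrite mulf_eq0 -[_ || _]negbK negb_or; apply/negP => /andP[a b]; apply: no; exists q.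
have /andP[/eqP cq lq] := pf _ fq.
have lpq : (plen q <= plen p)%N by rewrite leqNgt; apply/negP => /(star_short th) e; rewrite e eqxx in sq.
have := sq; rewrite star_end ?(svalP q) // coef_idr; case: (ptarget p =P _) => [e _|_]; last by rewrite eqxx.
move: sq; rewrite /star coef_idl; case: (psource p =P _) => [e' _|_]; last by rewrite eqxx.
by rewrite /pclosed e e' [endpoint _ _]cq eqxx (leq_trans lq).
Qed.

Lemma sub_reduced th f : potential f -> reduced f -> reduced (sub th f).
Proof.
move=> pf rf p lp; apply: big1 => q _; case: (ltnP (plen p) (plen q)) => l.
  by rewrite star_short // mulr0.
suff -> : f q = 0 by rewrite mul0r.
case: (plen q =P 2%N) => [/rf //|ne].
apply/eqP; apply: contraT => /pf /andP[_]; move: l ne; rewrite lp; lia.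
Qed.

End Substitutions.
Arguments sid {K Q}.
Arguments simgP {K Q}.

(** * Cyclic equivalence and its trace functionals *)

Section CyclicEquivalence.
Variables (K : fieldType) (Q : quiver).
Notation A := (cpath_alg K Q).
Implicit Types (f g h : A) (p q : qpath Q) (w : arrow Q -> nat).
Implicit Types (a : arrow Q) (v : vertex Q) (s t : seq (arrow Q)).

Lemma cspanD f g : commutator_span f -> commutator_span g -> commutator_span (f + g).
Proof.
case=> [k [c [x [y ->]]]] [l [d [z [u ->]]]].
exists (k + l)%N, (fun i => match split i with inl j => c j | inr j => d j end),
  (fun i => match split i with inl j => x j | inr j => z j end),
  (fun i => match split i with inl j => y j | inr j => u j end).
rewrite big_split_ord /=; congr (_ + _); apply: eq_bigr => i _.
  by case: (split _) (unsplitK (inl i : 'I_k + 'I_l)%type) => j //= [->].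
by case: (split _) (unsplitK (inr i : 'I_k + 'I_l)%type) => j //= [->].
Qed.

Lemma cspanZ c f : commutator_span f -> commutator_span (c *: f).
Proof.
case=> [k [d [x [y ->]]]]; exists k, (fun i => c * d i), x, y.
by rewrite scaler_sumr; apply: eq_bigr => i _; rewrite scalerA.
Qed.

Lemma cspan0 : commutator_span (0 : A).
Proof.
by exists 0%N, (fun=> 0), (fun=> 0), (fun=> 0); rewrite big_ord0.
Qed.

Lemma cyc_eq f g : f = g -> cyc_equiv f g.
Proof. by move=> -> N; exists 0; rewrite ?subrr ?subr0 //; apply: cspan0. Qed.

Lemma cyc_refl f : cyc_equiv f f. Proof. exact: cyc_eq. Qed.

Lemma cyc_scale c f g : cyc_equiv f g -> cyc_equiv (c *: f) (c *: g).
Proof.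
move=> h N; have [s hs fs] := h N; exists (c *: s); first exact: cspanZ.
by rewrite -!scalerBr => p /fs; rewrite coef_scale => ->; rewrite mulr0.
Qed.

Lemma cyc_add f g f' g' : cyc_equiv f g -> cyc_equiv f' g' -> cyc_equiv (f + f') (g + g').
Proof.
move=> h h' N; have [s hs fs] := h N; have [s' hs' fs'] := h' N.
exists (s + s'); first exact: cspanD.
have -> : f + f' - (g + g') - (s + s') = (f - g - s) + (f' - g' - s').
  by apply: cpath_algP => p; rewrite !coef_lin; ring.
exact: adicD.
Qed.

Lemma cyc_trans g f h : cyc_equiv f g -> cyc_equiv g h -> cyc_equiv f h.
Proof.
move=> a b; have := cyc_add a b; rewrite /cyc_equiv.
suff -> : f + g - (g + h) = f - h by [].
by apply: cpath_algP => p; rewrite !coef_lin; ring.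
Qed.

Lemma cyc_opp f g : cyc_equiv f g -> cyc_equiv (- f) (- g).
Proof. by move/(cyc_scale (-1)); rewrite !scaleN1r. Qed.

Lemma cyc_sym f g : cyc_equiv f g -> cyc_equiv g f.
Proof. by move/cyc_opp; rewrite /cyc_equiv opprK addrC. Qed.

Lemma cyc_sum (J : Type) (r : seq J) (P : pred J) (F G : J -> A) :
  (forall i, P i -> cyc_equiv (F i) (G i)) ->
  cyc_equiv (\sum_(i <- r | P i) F i) (\sum_(i <- r | P i) G i).
Proof. by move=> h; elim/big_rec2: _ => [|i x y Pi]; [apply: cyc_refl|apply: cyc_add; apply: h]. Qed.

Lemma cyc_comm f g : cyc_equiv (f * g) (g * f).
Proof.
move=> N; exists (f * g - g * f); last by rewrite subrr.
by exists 1%N, (fun=> 1), (fun=> f), (fun=> g); rewrite big_ord1 scale1r.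
Qed.

Lemma cyc_lim f g : (forall N, exists h, cyc_equiv h 0 /\ in_adic N (f - g - h)) ->
  cyc_equiv f g.
Proof.
move=> H N; have [h [h0 hN]] := H N; have [s hs sN] := h0 N; exists s => //.
by rewrite -(subrK h (f - g)) -addrA; apply: adicD; rewrite // -[h]subr0.
Qed.

Lemma sub_cyc th f g : cyc_equiv f g -> cyc_equiv (sub th f) (sub th g).
Proof.
move=> h N; have [s [k [c [x [y ->]]]] fs] := h N.
exists (\sum_(i < k) c i *: (sub th (x i) * sub th (y i) - sub th (y i) * sub th (x i))).
  by exists k, c, (fun i => sub th (x i)), (fun i => sub th (y i)).
have := sub_adic th fs; rewrite subB subB sub_sum; congr (in_adic _ (_ - _)).
by apply: eq_bigr => i _; rewrite subZ subB !sub_mul.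
Qed.

(** Such a path [p] is the commutator of its source idempotent with [p]. *)
Lemma cyc_nonclosed v s : endpoint v s != v -> cyc_equiv (mon v s : A) 0.
Proof.
move=> ne; have := cyc_comm (mon v [::]) (mon v s : A).
by rewrite (mon_mul_ne _ _ ne) mon_mul eqxx.
Qed.

Lemma cyc_rot v s t : endpoint v (s ++ t) = v ->
  cyc_equiv (mon v (s ++ t) : A) (mon (endpoint v s) (t ++ s)).
Proof.
rewrite /endpoint map_cat last_cat -/(endpoint v s) -/(endpoint _ t) => e.
by rewrite !mon_cat e; apply: cyc_comm.
Qed.

End CyclicEquivalence.

Section Trace.
Variables (K : fieldType) (Q : quiver) (c : qpath Q).
Notation A := (cpath_alg K Q).
Implicit Types (f g h : A) (p q : qpath Q).
Hypotheses (closed_c : pclosed c) (pos_c : (0 < plen c)%N).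

Lemma path_eq p q : (0 < plen p)%N -> parrows p = parrows q -> p = q.
Proof.
case: p q => [[v s] /= cs] [[v' s'] /= cs']; rewrite /plen /parrows /= => + e.
move: cs'; rewrite -e; case: s cs {e} => //= a s cs cs' _; apply: val_inj => /=.
by case/andP: cs => /eqP <- _; case/andP: cs' => /eqP <- _.
Qed.

Lemma rotP p : rotation_of c p <->
  exists2 i, (i <= plen c)%N & parrows p = rot i (parrows c).
Proof.
have E i : parrows (pcomp (pdrop i c) (ptake i c)) = rot i (parrows c).
  rewrite parrows_pcomp //.
  have /eqP := closed_c; rewrite -{1}(pcomp_take_drop i c) ptarget_pcomp //.
by split=> -[i le e]; exists i; rewrite // ?e //; apply: path_eq; rewrite /plen e ?size_rot.
Qed.

(** Both concatenations have the same arrows up to rotation. *)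
Lemma rotation_swap p q : ptarget p = psource q -> ptarget q = psource p ->
  rotation_of c (pcomp p q) -> rotation_of c (pcomp q p).
Proof.
move=> e1 e2 /rotP[i le]; rewrite parrows_pcomp // => e.
apply/rotP; rewrite parrows_pcomp //.
have sz : (size (parrows p) <= size (parrows c))%N.
  by rewrite -[size (parrows c)](size_rot i) -e size_cat leq_addr.
rewrite -(rot_size_cat (parrows p)) e rot_add_mod //; eexists; last by [].
by move: le sz; rewrite /plen; case: ifP; lia.
Qed.

Lemma rotation_closed p : rotation_of c p -> pclosed p.
Proof.
case=> i le ->; have /eqP e := closed_c.
have t : ptarget (pdrop i c) = psource (ptake i c).
  by move: e; rewrite -{1}(pcomp_take_drop i c) ptarget_pcomp.
by rewrite /pclosed ptarget_pcomp // psource_pcomp.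
Qed.

Lemma rotation_plen p : rotation_of c p -> plen p = plen c.
Proof. by case/rotP => i le e; rewrite /plen e size_rot. Qed.

Definition trace f : K :=
  \sum_(r <- paths_upto Q (plen c)) f r * (`[< rotation_of c r >])%:R.

Lemma traceD f g : trace (f + g) = trace f + trace g.
Proof. by rewrite -big_split; apply: eq_bigr => r _; rewrite coef_add mulrDl. Qed.
Lemma traceZ x f : trace (x *: f) = x * trace f.
Proof. by rewrite big_distrr; apply: eq_bigr => r _; rewrite coef_scale -mulrA. Qed.
Lemma traceB f g : trace (f - g) = trace f - trace g.
Proof. by rewrite traceD -scaleN1r traceZ mulN1r. Qed.
Lemma trace_sum (J : Type) (r : seq J) (P : pred J) (F : J -> A) :
  trace (\sum_(i <- r | P i) F i) = \sum_(i <- r | P i) trace (F i).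
Proof.
apply: (big_morph trace traceD).
by apply: big1 => r' _; rewrite coef_zero mul0r.
Qed.

Lemma trace_monom p : trace (monom K p) = (`[< rotation_of c p >])%:R.
Proof.
case: (leqP (plen p) (plen c)) => le.
  have M r : monom K p r = (r == p)%:R by [].
  rewrite /trace (bigD1_seq p) ?mem_paths_upto ?paths_upto_uniq //= eqxx mul1r.
  by rewrite big1 ?addr0 // => r /negbTE ->; rewrite mul0r.
rewrite [RHS](_ : _ = 0); last first.
  by case: asboolP => // /rotation_plen e; move: le; rewrite e ltnn.
rewrite /trace big_seq big1 // => r; rewrite mem_paths_upto => lr /=.
by case: eqP => [e|]; rewrite ?mul0r //; move: le; rewrite -e ltnNge lr.
Qed.

Lemma trace_eq0 h : (forall p, rotation_of c p -> h p = 0) -> trace h = 0.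
Proof.
move=> h0; apply: big1 => r _; case: asboolP => [/h0 ->|]; by rewrite ?mul0r ?mulr0.
Qed.

Lemma trace_adic f : in_adic (plen c).+1 f -> trace f = 0.
Proof. by move=> h; apply: trace_eq0 => p /rotation_plen e; apply: h; rewrite e. Qed.

Lemma trace_monom_comm p q :
  trace (monom K p * monom K q) = trace (monom K q * monom K p).
Proof.
have E x y : ptarget x = psource y -> ptarget y != psource x ->
    trace (monom K (pcomp x y)) = 0.
  move=> e ne; rewrite trace_monom; case: asboolP => // /rotation_closed.
  by rewrite /pclosed ptarget_pcomp // psource_pcomp // (negbTE ne).
have Z : trace 0 = 0 by apply: trace_eq0.
rewrite !monomM; case: eqP => [e1|/eqP ne1]; case: eqP => [e2|/eqP ne2]; rewrite ?Z //; try by rewrite E.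
rewrite !trace_monom; congr (nat_of_bool _)%:R.
by apply/asboolP/asboolP; apply: rotation_swap.
Qed.

(** Only short paths matter, so this reduces to products of two paths. *)
Lemma trace_comm f g : trace (f * g) = trace (g * f).
Proof.
pose N := plen c.
have T (x y : A) : trace (x * y) = trace (trunc N x * trunc N y).
  by apply/eqP; rewrite -subr_eq0 -traceB trace_adic //; apply: truncM.
rewrite T [RHS]T /trunc !mulr_suml !trace_sum.
under eq_bigr do rewrite mulr_sumr trace_sum.
under [RHS]eq_bigr do rewrite mulr_sumr trace_sum.
rewrite exchange_big; apply: eq_bigr => p _; apply: eq_bigr => q _.
by rewrite -!(scaleAl, scaleAr) !traceZ trace_monom_comm mulrCA.
Qed.

(** Elements deep in the filtration have no coefficient on the rotations of
    [c], so the closure of the commutators is not seen by the trace. *)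
Lemma trace_cyc f g : cyc_equiv f g -> trace f = trace g.
Proof.
move=> h; have [s [k [d [x [y ->]]]] fs] := h (plen c).+1.
have := trace_adic fs; rewrite !traceB trace_sum big1 ?subr0.
  by move/eqP; rewrite subr_eq0 => /eqP.
by move=> i _; rewrite traceZ traceB trace_comm subrr mulr0.
Qed.

Lemma trace_self : trace (monom K c) = 1.
Proof.
rewrite trace_monom; case: asboolP => // -[]; apply/rotP; exists 0%N => //.
by rewrite rot0.
Qed.

(** Rotations of [c] have the same arrows as [c]. *)
Lemma trace_missing p a : a \in parrows c -> a \notin parrows p -> trace (monom K p) = 0.
Proof.
move=> ac ap; rewrite trace_monom; case: asboolP => // /rotP[i _ e].
by move: ap; rewrite e mem_rot ac.
Qed.

Lemma contains_trace f : contains f c -> trace f != 0.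
Proof.
case=> lam [h [lam0 _ e h0]].
by rewrite (trace_cyc e) traceD traceZ trace_self mulr1 trace_eq0 // addr0.
Qed.

End Trace.

(** * Cyclic words on the double quiver *)

(** Reading a cycle on from an element outside [P], the first element in [P]
    comes right after one that is not in [P]. *)
Lemma rot_boundary (T : eqType) (P : pred T) (s : seq T) : has P s -> ~~ all P s ->
  exists k g t, [/\ rot k s = g :: t, P g & ~~ P (last g t)].
Proof.
move=> hP; rewrite -has_predC => hN.
have [k [y [t [ek Ny]]]] : exists k y t, rot k s = y :: t /\ ~~ P y.
  exists (find (predC P) s); move: hN; rewrite has_find => lt.
  have [y0 s0] : exists y0, s = y0 :: behead s by case: (s) lt => // y0; exists y0.
  exists (nth y0 s (find (predC P) s)), (drop (find (predC P) s).+1 s ++ take (find (predC P) s) s).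
  rewrite /rot (drop_nth y0) //; split=> //.
  by apply: (@nth_find _ y0 (predC P)); rewrite has_find.
have ht : has P t.
  have : has P (rot k s) by rewrite /rot has_cat orbC -has_cat cat_take_drop.
  by rewrite ek /= (negbTE Ny).
have kn : (k <= size s)%N \/ rot k s = s.
  by case: (leqP k (size s)) => l; [left|right; apply: rot_oversize; apply: ltnW].
pose l := find P t; have lt : (l < size t)%N by rewrite -has_find.
have R2 : rot l.+1 (y :: t) = nth y t l :: drop l.+1 t ++ y :: take l t.
  by rewrite /rot /= (drop_nth y) //.
have Pg : P (nth y t l) by apply: nth_find.
have Nl : ~~ P (last (nth y t l) (drop l.+1 t ++ y :: take l t)).
  rewrite last_cat /=; have := mem_last y (take l t); rewrite inE => /predU1P[-> //|].
  case/(nthP y) => r; rewrite size_takel; last exact: ltnW.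
  by move=> rl <-; rewrite nth_take // before_find.
have sz : size t = (size s).-1 by rewrite -(size_rot k s) ek.
case: kn => [le|es]; last first.
  by exists l.+1, (nth y t l), (drop l.+1 t ++ y :: take l t); rewrite -es ek R2.
have := @rot_add_mod _ l.+1 k s; rewrite ek R2 => H.
exists (if (l.+1 + k <= size s)%N then l.+1 + k else l.+1 + k - size s)%N.
by exists (nth y t l), (drop l.+1 t ++ y :: take l t); split=> //; rewrite -H //; lia.
Qed.

Lemma composable_cons (Q : quiver) (u : vertex Q) (b : arrow Q) s :
  composable u (b :: s) = (qtail b == u) && composable (qhead b) s.
Proof. by []. Qed.

Lemma all_cons (T : Type) (P : pred T) x s : all P (x :: s) = P x && all P s.
Proof. by []. Qed.

Lemma endpoint_cons (Q : quiver) (u : vertex Q) (b : arrow Q) s :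
  endpoint u (b :: s) = endpoint (qhead b) s.
Proof. by []. Qed.

Lemma endpoint_cat (Q : quiver) (u : vertex Q) (s t : seq (arrow Q)) :
  endpoint u (s ++ t) = endpoint (endpoint u s) t.
Proof. by rewrite /endpoint map_cat last_cat. Qed.

Lemma endpoint_rcons (Q : quiver) (u : vertex Q) s (b : arrow Q) :
  endpoint u (rcons s b) = qhead b.
Proof. by rewrite /endpoint map_rcons last_rcons. Qed.

Lemma composable_rcons (Q : quiver) (u : vertex Q) s (b : arrow Q) :
  composable u (rcons s b) = composable u s && (qtail b == endpoint u s).
Proof. by rewrite -cats1 composable_cat /= andbT. Qed.

Lemma wts_cons (Q : quiver) (w : arrow Q -> nat) s b :
  wts w (b :: s) = (w b + wts w s)%N.
Proof. by []. Qed.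

Lemma wts_nil (Q : quiver) (w : arrow Q -> nat) : wts w [::] = 0%N.
Proof. by []. Qed.

Lemma wts_rcons (Q : quiver) (w : arrow Q -> nat) s b :
  wts w (rcons s b) = (wts w s + w b)%N.
Proof. by rewrite -cats1 wts_cat /wts /= addn0. Qed.

Section DoubleQuiver.
Variables (n : nat) (I : {set 'I_n}).
Notation Qd := (double_quiver I).
Notation slot := (slot I).
Notation nslots := (nslots I).
Notation nth_slot := (@nth_slot n I).
Implicit Types (c : slot) (i j k : 'I_nslots) (a b e g : arrow Qd) (v : vertex (double_quiver I)).

Notation src c := ((val c).1 : vertex Qd).
Notation tgt c := ((val c).2 : vertex Qd).

Notation tl a := (@qtail Qd a).
Notation hd a := (@qhead Qd a).

(** The key of a slot determines its position in the list of slots, and it is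
    also the sum of the ends of each of its arrows; so weights of arrows can be
    expressed without locating the slot they belong to. *)
Definition key c : nat := ((val c).1 + (val c).2)%N.
Definition akey a : nat := (tl a + hd a)%N.

Lemma nth_slot_key i j : (key (nth_slot i) < key (nth_slot j))%N = (i < j)%N.
Proof.
have x0 := nth_slot i.
have H (u v : 'I_nslots) : (u < v)%N -> (key (nth_slot u) < key (nth_slot v))%N.
  move=> uv; rewrite /nth_slot !(tnth_nth x0) /=.
  have S : sorted ltn (map key (slots I)) := slots_sorted I.
  have In (w : 'I_nslots) : nat_of_ord w \in gtn (size (map key (slots I))).
    by rewrite size_map (eqP (size_slots I)); exact: ltn_ord.
  have := sorted_ltn_nth ltn_trans 0%N S _ _ (In u) (In v) uv.
  by rewrite !(nth_map x0) ?(eqP (size_slots I)) ?ltn_ord.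
case: (ltngtP i j) => [/H|/H|/val_inj ->] //; last by rewrite ltnn.
by move=> h; apply/negbTE; rewrite -leqNgt ltnW.
Qed.

Lemma nth_slot_surj c : exists k, nth_slot k = c.
Proof.
have lt : (index c (slots I) < nslots)%N by rewrite -(eqP (size_slots I)) index_mem mem_slots.
by exists (Ordinal lt); rewrite /nth_slot (tnth_nth c) /= nth_index ?mem_slots.
Qed.

Lemma nth_slot_inj : injective nth_slot.
Proof.
move=> i j e; apply: val_inj; have := nth_slot_key i j; have := nth_slot_key j i.
by rewrite e ltnn; case: ltngtP.
Qed.

(** Keys skip a value where a vertex has no loop, so successors are recognized by
    the absence of a slot in between. *)
Lemma nth_slot_succ i j : (key (nth_slot i) < key (nth_slot j))%N ->
  (forall c, (key (nth_slot i) < key c < key (nth_slot j))%N -> False) -> j = i.+1 :> nat.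
Proof.
rewrite nth_slot_key => lt gap; apply/eqP; rewrite eqn_leq lt andbT leqNgt.
apply/negP => l2; have l3 : (i.+1 < nslots)%N by apply: ltn_trans (ltn_ord j).
by apply: (gap (nth_slot (Ordinal l3))); rewrite !nth_slot_key /= ltnSn.
Qed.

Lemma key_bound c : (key c < 2 * n)%N.
Proof. by have := ltn_ord (val c).1; have := ltn_ord (val c).2; rewrite /key; lia. Qed.

Lemma arrow_inj a b : tl a = tl b -> hd a = hd b -> a = b.
Proof.
move=> e1 e2; apply: val_inj; rewrite [LHS]surjective_pairing [RHS]surjective_pairing.
by congr pair.
Qed.

Lemma arrowP a : [\/ hd a = (tl a).+1 :> nat, tl a = (hd a).+1 :> nat
                   | tl a = hd a /\ tl a \notin I].
Proof.
case/or3P: (valP a) => h; [apply: Or31|apply: Or32|apply: Or33].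
- exact/eqP.
- exact/eqP.
by case/andP: h => /eqP.
Qed.

Lemma slotP c : (val c).2 = (val c).1.+1 :> nat /\ ~~ is_loop I (val c) \/
  [/\ (val c).2 = (val c).1, (val c).1 \notin I & is_loop I (val c)].
Proof.
case/orP: (valP c) => h; [left|right].
  split; first exact/eqP.
  by rewrite /is_loop; case: eqP => // e; move/eqP: h; rewrite /= e => /n_Sn.
by have := h; case/andP=> /eqP e ->; split.
Qed.

(** For a loop both arrows are the loop itself. Since [sA] is empty then, in all
    cases [eA], [eB] and [eX] are [A], [B] and [x = A B] for the slot. *)
Definition fwd_arrow c : arrow Qd := exist _ (val c) (fwd_arrow_subproof c).
Definition bwd_arrow c : arrow Qd := exist _ ((val c).2, (val c).1) (bwd_arrow_subproof c).
Definition sA c : seq (arrow Qd) := if is_loop I (val c) then [::] else [:: fwd_arrow c].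
Definition sX c : seq (arrow Qd) := rcons (sA c) (bwd_arrow c).

Lemma slot_of_fwd a : hd a = (tl a).+1 :> nat ->
  exists i, [/\ (val (nth_slot i)) = (tl a, hd a), fwd_arrow (nth_slot i) = a,
                ~~ is_loop I (val (nth_slot i)) & key (nth_slot i) = akey a].
Proof.
move=> h; have hc : is_fwd (tl a, hd a) || is_loop I (tl a, hd a).
  by rewrite /is_fwd /= h eqxx.
have [i e] := nth_slot_surj (exist (fun p => is_fwd p || is_loop I p) _ hc); exists i; rewrite e; split=> //.
  exact: arrow_inj.
by rewrite /is_loop /=; case: eqP => // e1; move: h; rewrite [tl a]e1 => h; have := n_Sn _ h.
Qed.

Lemma slot_of_loop v : v \notin I ->
  exists i, [/\ (val (nth_slot i)) = (v, v), is_loop I (val (nth_slot i))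
                & key (nth_slot i) = (v + v)%N].
Proof.
move=> h; have L : is_loop I (v, v) by rewrite /is_loop /= eqxx.
have hc : is_fwd (v, v) || is_loop I (v, v) by rewrite L orbT.
have [i e] := nth_slot_surj (exist (fun p => is_fwd p || is_loop I p) _ hc).
by exists i; rewrite e; split.
Qed.

Lemma endpoint_sA c : endpoint (src c) (sA c) = (tgt c).
Proof.
by rewrite /sA; case: (slotP c) => [[e /negbTE ->]|[e _ ->]] //=; rewrite e.
Qed.

Lemma composable_sA c : composable (src c) (sA c).
Proof. by rewrite /sA; case: ifP => //= _; rewrite eqxx. Qed.

Variable K : fieldType.
Notation A := (cpath_alg K Qd).

Definition eA c : A := mon (src c) (sA c).
Definition eB c : A := mon (tgt c) [:: bwd_arrow c].
Definition eX c : A := mon (src c) (sX c).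

Lemma eX_AB c : eX c = eA c * eB c.
Proof. by rewrite /eX /sX -cats1 mon_cat endpoint_sA. Qed.

Definition wX w c : nat := wts w (sX c).

Lemma wX_AB w c : wX w c = (wts w (sA c) + w (bwd_arrow c))%N.
Proof. by rewrite /wX /sX -cats1 wts_cat /wts /= addn0. Qed.

(** From the left end of a slot there is one arrow of that slot to take, and for
    a pair one arrow back: the walk is a power of [x]. *)
Lemma walk_in_slot c s : s != [::] -> composable (src c) s ->
  endpoint (src c) s = (src c) -> all (fun a => akey a == key c) s ->
  exists d, [/\ (0 < d)%N, mon (src c) s = eX c ^+ d & forall w, wts w s = (d * wX w c)%N].
Proof.
have [m] := ubnP (size s); elim: m s => // m IH s sz ne cs es ks.
have [t [st ct et kt]] : exists t, [/\ s = sX c ++ t, composable (src c) t,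
    endpoint (src c) t = (src c) & all (fun a => akey a == key c) t].
  case: s ne cs es ks {sz} => // a s _.
  rewrite composable_cons all_cons endpoint_cons => /andP[/eqP ta cs] es /andP[/eqP ka ks].
  rewrite /sX /sA.
  case: (slotP c) => [[e nl]|[e _ l]]; rewrite ?(negbTE nl) ?l.
    have ha : hd a = tgt c.
      by apply: ord_inj; move: ka; rewrite /akey /key ta; lia.
    have ea : a = fwd_arrow c by apply: arrow_inj.
    case: s cs es ks => [_|b s].
      by rewrite [endpoint _ _]ha => e'; move: e; rewrite [tgt c]e' => h; have := n_Sn _ h.
    rewrite composable_cons all_cons endpoint_cons => /andP[/eqP tb cs] es /andP[/eqP kb ks].
    have hb : hd b = src c.
      by apply: ord_inj; move: kb; rewrite /akey /key tb ha; lia.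
    have eb : b = bwd_arrow c by apply: arrow_inj; rewrite ?tb.
    by rewrite hb in cs es; exists s; rewrite -ea -eb.
  have ha : hd a = src c.
    by apply: ord_inj; move: ka; rewrite /akey /key ta e; lia.
  have ea : a = bwd_arrow c by apply: arrow_inj; rewrite ?ta ?ha.
  by rewrite ha in cs es; exists s; rewrite -ea.
have W w : wts w s = (wX w c + wts w t)%N by rewrite st wts_cat.
have M : mon (src c) s = eX c * (mon (src c) t : A).
  by rewrite st mon_cat /sX endpoint_rcons.
case: (t =P [::]) => [t0|/eqP tne].
  exists 1%N; split=> // [|w]; rewrite ?expr1 ?mul1n; last by rewrite W t0 addn0.
  by rewrite st t0 cats0.
have [|d [d0 Md Wd]] := IH t _ tne ct et kt.
  by move: sz; rewrite st size_cat /sX size_rcons; lia.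
by exists d.+1; split=> // [|w]; rewrite ?M ?Md ?exprS // W Wd mulSn.
Qed.

(** The words to keep and the words to remove. In the second shape the path [t]
    is parallel to [B_i], so it can be subtracted from [B_i]. The weight of the
    word is recorded for every weight function, as several are used later. *)
Variant cyclic_shape v s : Prop :=
| ShapePower i d of (0 < d)%N & cyc_equiv (mon v s : A) (eX (nth_slot i) ^+ d)
    & (forall w, wts w s = (d * wX w (nth_slot i))%N)
| ShapeTurn i j t of j = i.+1 :> nat
    & composable (tgt (nth_slot i)) t
    & endpoint (tgt (nth_slot i)) t = (src (nth_slot i)) & (0 < size t)%N
    & cyc_equiv (mon v s : A)
        (eA (nth_slot i) * eX (nth_slot j) * mon (tgt (nth_slot i)) t)
    & (forall w, wts w s = (wts w (sA (nth_slot i)) + wX w (nth_slot j) + wts w t)%N).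

Lemma wts_rot w r (s : seq (arrow Qd)) : wts w (rot r s) = wts w s.
Proof. by rewrite /rot wts_cat addnC -wts_cat cat_take_drop. Qed.

Lemma shape_rot r v s : composable v s -> endpoint v s = v ->
  let u := endpoint v (take r s) in
  [/\ composable u (rot r s), endpoint u (rot r s) = u
    & cyclic_shape u (rot r s) -> cyclic_shape v s].
Proof.
move=> cs es u; have E : endpoint u (drop r s) = v.
  by rewrite -[RHS]es -[in RHS](cat_take_drop r s) /endpoint map_cat last_cat.
have C : cyc_equiv (mon v s : A) (mon u (rot r s)).
  by rewrite -{1}(cat_take_drop r s); apply: cyc_rot; rewrite cat_take_drop.
move: cs; rewrite -{1}(cat_take_drop r s) composable_cat => /andP[c1 c2].
split.
- by rewrite /rot composable_cat c2 E c1.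
- by rewrite /rot /endpoint map_cat last_cat -!/(endpoint _ _) E.
case=> [i d d0 e W|i j t ij ct et t0 e W].
  by apply: (ShapePower (i := i) (d := d)) => //; [apply: cyc_trans e|move=> w; rewrite -(wts_rot w r)].
by apply: (ShapeTurn (i := i) (j := j) (t := t)) => //; [apply: cyc_trans e|move=> w; rewrite -(wts_rot w r)].
Qed.

Lemma max_key (s : seq (arrow Qd)) : s != [::] ->
  exists2 g, g \in s & forall b, b \in s -> (akey b <= akey g)%N.
Proof.
elim: s => // a s IH _; case: (s =P [::]) => [->|/eqP /IH[g gs hg]].
  by exists a; rewrite ?mem_head // => b; rewrite inE => /eqP ->.
case: (leqP (akey g) (akey a)) => l.
  exists a; rewrite ?mem_head // => b; rewrite inE => /predU1P[->//|/hg h].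
  exact: leq_trans l.
exists g; rewrite ?inE ?gs ?orbT // => b; rewrite inE => /predU1P[->|/hg //].
exact: ltnW.
Qed.

Lemma slot_of_arrow a : exists i, key (nth_slot i) = akey a /\
  (tl a = src (nth_slot i) \/ hd a = src (nth_slot i)).
Proof.
case: (arrowP a) => [h|h|[h hI]].
- by have [i [e _ _ k]] := slot_of_fwd h; exists i; rewrite e; split=> //; left.
- have hc : is_fwd (hd a, tl a) || is_loop I (hd a, tl a) by rewrite /is_fwd /= h eqxx.
  have [i e] := nth_slot_surj (exist (fun p => is_fwd p || is_loop I p) _ hc).
  by exists i; rewrite e; split; [rewrite /key /akey /= addnC|right].
have [i [e _ k]] := slot_of_loop hI; exists i; rewrite e; split; last by left.
by rewrite k /akey -h.
Qed.

Lemma shape_pure v s : s != [::] -> composable v s -> endpoint v s = v ->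
  (forall a b, a \in s -> b \in s -> akey a = akey b) -> cyclic_shape v s.
Proof.
case: s => // a s _ cs es ks; have [i [ki hi]] := slot_of_arrow a.
have al : all (fun b => akey b == key (nth_slot i)) (a :: s).
  by apply/allP => b bs; rewrite ki; apply/eqP; apply: ks; rewrite // mem_head.
have [/eqP ta _] := andP cs.
case: hi => [hi|hi].
  have vi : v = src (nth_slot i) by rewrite -ta.
  have [] := @walk_in_slot (nth_slot i) (a :: s); rewrite -?vi //.
  by move=> d [d0 M W]; apply: (ShapePower d0 _ W); apply: cyc_eq.
have [c1 e1 H] := shape_rot 1 cs es; apply: H; move: c1 e1.
have -> : endpoint v (take 1 (a :: s)) = src (nth_slot i) by rewrite /= take0 -hi.
move=> c1 e1; have [//||d [d0 M W]] := @walk_in_slot (nth_slot i) (rot 1 (a :: s)) _ c1 e1.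
- by rewrite rot1_cons; case: (s).
- by apply/allP => b; rewrite mem_rot => /(allP al).
by apply: (ShapePower d0 _ W); apply: cyc_eq.
Qed.

(** The arrow [g] has the largest key and is entered from an arrow of smaller
    key. So [g] does not point left, since then no arrow into its source would
    have a smaller key. If [g] is a loop it is entered by [A_i] from the slot just
    before. If [g] goes right, the next arrow must go back, which completes [x_j];
    before it stands the arrow [A_i] if there is no loop at the source of [g], and
    otherwise [A_i] is trivial. *)
Lemma shape_peak v g s : composable v (g :: s) -> endpoint v (g :: s) = v ->
  (forall b, b \in g :: s -> (akey b <= akey g)%N) ->
  (akey (last g s) < akey g)%N -> cyclic_shape v (g :: s).
Proof.
case/lastP: s => [|s e]; first by rewrite ltnn.
rewrite last_rcons endpoint_cons endpoint_rcons composable_cons composable_rcons.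
case/andP=> /eqP tg /andP[cs /eqP te] he mx ke.
have E1 : endpoint v (g :: s) = tl e by rewrite endpoint_cons te.
(* a walk through [e] last can be read from [e] on *)
have R i : ~~ is_loop I (val (nth_slot i)) -> fwd_arrow (nth_slot i) = e ->
    cyc_equiv (mon v (g :: rcons s e) : A) (eA (nth_slot i) * mon v (g :: s)).
  move=> nl fe; rewrite -rcons_cons -cats1.
  have := @cyc_rot K Qd v (g :: s) [:: e]; rewrite endpoint_cat E1 endpoint_cons => /(_ he).
  move/cyc_trans; apply; apply: cyc_eq.
  rewrite mon_cat /eA /sA (negbTE nl) fe endpoint_cons [endpoint _ _]he.
  by congr (mon _ _ * _); rewrite -fe.
have hE := arrowP e; have hG := arrowP g.
have tgN : tl g = v :> nat by rewrite tg.
have heN : hd e = v :> nat by rewrite he.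
move: ke; rewrite /akey he tg => ke.
case: hG => [hg|hg|[hg hI]]; last first.
- (* a loop: it is entered from the left *)
  have fe : hd e = (tl e).+1 :> nat.
    have hgN := congr1 (@nat_of_ord n) hg.
    by case: hE => [//|h|[/(congr1 (@nat_of_ord n)) h _]]; lia.
  have [i [ei fi nl ki]] := slot_of_fwd fe.
  have vI : v \notin I by rewrite -tg.
  have [j [ej lj kj]] := slot_of_loop vI.
  have ij : j = i.+1 :> nat.
    apply: nth_slot_succ; rewrite ki kj /akey he; first by lia.
    by move=> c; lia.
  have bj : bwd_arrow (nth_slot j) = g by apply: arrow_inj; rewrite ?tg -?hg ?tg /= ej.
  have src_i : src (nth_slot i) = tl e by rewrite ei.
  have tgt_i : tgt (nth_slot i) = v by rewrite ei -he.
  apply: (ShapeTurn (i := i) (j := j) (t := s)) => //.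
  + by rewrite tgt_i; move: cs; rewrite -hg tg.
  + by rewrite tgt_i src_i te -hg tg.
  + case: s te {cs mx E1 R} => // te; have {}te : tl e = hd g := te.
    by move: fe; rewrite te -hg; lia.
  + apply: cyc_trans (R i nl fi) _; apply: cyc_eq.
    rewrite -mulrA; congr (_ * _); rewrite -[g :: s]cat1s mon_cat tgt_i; congr (_ * _).
      by rewrite /eX /sX /sA lj ej bj.
    by rewrite endpoint_cons -hg tg.
  move=> w; rewrite wts_cons wts_rcons wX_AB /sA lj (negbTE nl) bj fi wts_cons !wts_nil; lia.
- by case: hE => [h|h|[/(congr1 (@nat_of_ord n)) h _]]; lia.
(* a step to the right: it can only be followed by the step back *)
case: s cs te E1 R mx => [_ te|g2 s].
  by move: ke; rewrite (te : tl e = hd g); lia.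
rewrite composable_cons endpoint_cons => /andP[/eqP tg2 cs] te E1 R mx.
have h2 : hd g2 = v.
  have := mx g2; rewrite !inE eqxx orbT => /(_ isT); rewrite /akey tg2 tg => le.
  have tg2N : tl g2 = hd g :> nat by rewrite tg2.
  by apply: ord_inj; case: (arrowP g2) => [h|h|[/(congr1 (@nat_of_ord n)) h _]]; lia.
have [j [ej fj nlj kj]] := slot_of_fwd hg.
have bj : bwd_arrow (nth_slot j) = g2 by apply: arrow_inj; rewrite ?tg2 ?h2 -?tg /= ej.
have X : eX (nth_slot j) = mon v [:: g; g2] by rewrite /eX /sX /sA (negbTE nlj) fj bj ej tg.
have WX w : wX w (nth_slot j) = (w g + w g2)%N by rewrite /wX /sX /sA (negbTE nlj) fj bj !wts_cons wts_nil addn0.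
have S : mon v [:: g, g2 & s] = eX (nth_slot j) * mon v s :> A.
  by rewrite X -[[:: g, g2 & s]]/([:: g; g2] ++ s) mon_cat !endpoint_cons [endpoint _ _]h2.
rewrite h2 in cs te.
case: (boolP (v \in I)) => vI.
  have fe : hd e = (tl e).+1 :> nat.
    case: hE => [//|h|[h hI]]; first by lia.
    by move: hI; rewrite h he vI.
  have [i [ei fi nl ki]] := slot_of_fwd fe.
  have ij : j = i.+1 :> nat.
    apply: nth_slot_succ; rewrite ki kj /akey he tg; first by lia.
    move=> c /andP[l1 l2]; case: (slotP c) => [[h _]|[h hI _]].
      by move: l1 l2; rewrite /key h; lia.
    have ce : src c = v.
      by apply: ord_inj; move: l1 l2; rewrite /key h; lia.
    by move: hI; rewrite ce vI.
  have src_i : src (nth_slot i) = tl e by rewrite ei.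
  have tgt_i : tgt (nth_slot i) = v by rewrite ei -he.
  apply: (ShapeTurn (i := i) (j := j) (t := s)) => //.
  + by rewrite tgt_i.
  + by rewrite tgt_i src_i te.
  + case: s te {cs mx E1 R S} => // te; have {}te : tl e = v := te.
    by move: fe; rewrite te; lia.
  + by apply: cyc_trans (R i nl fi) _; apply: cyc_eq; rewrite S mulrA tgt_i.
  by move=> w; rewrite WX !wts_cons wts_rcons /sA (negbTE nl) fi wts_cons wts_nil; lia.
have [i [ei li ki]] := slot_of_loop vI.
have ij : j = i.+1 :> nat.
  apply: nth_slot_succ; rewrite ki kj /akey tg; first by lia.
  by move=> c; lia.
apply: (ShapeTurn (i := i) (j := j) (t := rcons s e)) => //.
- by rewrite ei /= composable_rcons cs te eqxx.
- by rewrite ei /= endpoint_rcons.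
- by rewrite size_rcons.
- apply: cyc_eq; have -> : tgt (nth_slot i) = v by rewrite ei.
  have -> : eA (nth_slot i) = mon v [::].
    by rewrite /eA /sA li ei.
  have -> : g :: rcons (g2 :: s) e = [:: g; g2] ++ rcons s e by [].
  by rewrite mon_cat (h2 : endpoint v [:: g; g2] = v) X [mon v [::] * _]mon_mul eqxx.
by move=> w; rewrite WX /sA li rcons_cons !wts_cons wts_nil; lia.
Qed.

(** Either all keys are equal or, somewhere along the cycle, an arrow of maximal
    key follows one of smaller key; rotate there. *)
Lemma cyclic_shapeP v s : s != [::] -> composable v s -> endpoint v s = v ->
  cyclic_shape v s.
Proof.
move=> ne cs es; have [g gs mx] := max_key ne; pose P a := akey a == akey g.
case: (boolP (all P s)) => [/allP al|na].
  by apply: shape_pure => // a b /al /eqP -> /al /eqP ->.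
have hP : has P s by apply/hasP; exists g; rewrite // /P.
have [r [b [t [er Pb Nb]]]] := rot_boundary hP na.
have [cr er' H] := shape_rot r cs es; apply: H; move: cr er'; rewrite er => cr er'.
have M x : x \in b :: t -> (akey x <= akey b)%N.
  by rewrite -er mem_rot (eqP Pb); apply: mx.
apply: shape_peak => //; rewrite ltn_neqAle M ?mem_last // andbT.
by rewrite (eqP Pb).
Qed.

End DoubleQuiver.

(** * Weights and substitutions on the double quiver *)

Section Weights.
Variables (n : nat) (I : {set 'I_n}).
Notation Qd := (double_quiver I).
Notation slot := (slot I).
Notation nslots := (nslots I).
Notation nth_slot := (@nth_slot n I).
Implicit Types (c : slot) (i j k : 'I_nslots) (a b : arrow Qd).
Notation tl a := (@qtail Qd a).
Notation hd a := (@qhead Qd a).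
Notation src c := ((val c).1 : vertex Qd).
Notation tgt c := ((val c).2 : vertex Qd).

(** For [deg_wt] every [x_i] has weight 2. The weight [ord_wt] refines it:
    [x_i] has weight [2 (11 n - key)], which strictly decreases from left to
    right. The constant 11 ensures that a word of degree at least 5, of weight
    at least [5 * 9 n = 45 n], is heavier than [x_i x_j], of weight at most
    [44 n], for all [i] and [j]. *)
Definition deg_wt a : nat := if is_loop I (tl a, hd a) then 2 else 1.
Definition ord_wt a : nat := (deg_wt a * (11 * n - akey a))%N.
Definition Xord i : nat := (2 * (11 * n - key (nth_slot i)))%N.

Lemma akey_bound a : (akey a < 2 * n)%N.
Proof. by have := ltn_ord (tl a); have := ltn_ord (hd a); rewrite /akey; lia. Qed.

Lemma deg_wt_bound a : (0 < deg_wt a <= 2)%N.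
Proof. by rewrite /deg_wt; case: ifP. Qed.

Lemma ord_wt_deg a : (9 * n * deg_wt a <= ord_wt a)%N.
Proof. by rewrite /ord_wt mulnC leq_mul2l; have := akey_bound a; lia. Qed.

Lemma ord_wt_bound a : (0 < ord_wt a <= 22 * n)%N.
Proof.
have := akey_bound a; have := deg_wt_bound a; rewrite /ord_wt => /andP[l1 l2] k.
by rewrite muln_gt0 l1 /=; apply/andP; split; [lia|apply: leq_trans (leq_mul l2 (leq_subr _ _)) _; lia].
Qed.

Lemma deg_wt_bwd c : deg_wt (bwd_arrow c) = if is_loop I (val c) then 2%N else 1%N.
Proof.
rewrite /deg_wt /=; case: (slotP c) => [[e l]|[e h l]].
  rewrite (negbTE l) /is_loop /= ifF //; apply/negP => /andP[/eqP e'].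
  by move: e; rewrite e' => h; have := n_Sn _ h.
by rewrite l e -[X in is_loop I X]/((val c).1, (val c).1) -{2}e -surjective_pairing l.
Qed.

Lemma deg_wt_fwd c : ~~ is_loop I (val c) -> deg_wt (fwd_arrow c) = 1%N.
Proof. by move=> /negbTE h; rewrite /deg_wt /= -surjective_pairing h. Qed.

Lemma akey_bwd c : akey (bwd_arrow c) = key c.
Proof. by rewrite /akey /key /= addnC. Qed.

Lemma wX_ord i : wX ord_wt (nth_slot i) = Xord i.
Proof.
rewrite wX_AB /sA /ord_wt deg_wt_bwd akey_bwd /Xord; case: ifP => [_|/negbT l].
  by rewrite wts_nil.
by rewrite wts_cons wts_nil deg_wt_fwd // (_ : akey (fwd_arrow _) = key (nth_slot i)) //; lia.
Qed.

Lemma wX_deg c : wX deg_wt c = 2%N.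
Proof.
rewrite wX_AB /sA deg_wt_bwd; case: ifP => [_|/negbT l]; first by rewrite wts_nil.
by rewrite wts_cons wts_nil deg_wt_fwd.
Qed.

Lemma Xord_bound i : (18 * n < Xord i <= 22 * n)%N.
Proof. by have := key_bound (nth_slot i); rewrite /Xord; lia. Qed.

Lemma Xord_succ i j : (i < j)%N -> (Xord j + 2 <= Xord i)%N.
Proof.
by rewrite -nth_slot_key; have := key_bound (nth_slot j); rewrite /Xord; lia.
Qed.

Variable K : fieldType.
Notation A := (cpath_alg K Qd).
Notation ord_filt := (@filt K Qd ord_wt).

Definition Ai i : A := eA K (nth_slot i).
Definition Bi i : A := eB K (nth_slot i).
Definition Xi i : A := eX K (nth_slot i).
Definition Xi' i : A := Bi i * Ai i.
(** Zero for the last slot, and otherwise a single term. Sums over the successor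
    avoid a case distinction on the position of [i]. *)
Definition Xnext i : A := \sum_(j < nslots | j == i.+1 :> nat) Xi j.
Definition base_potential : A := \sum_(i < nslots) Xi' i * Xnext i.

Definition wA w i : nat := wts w (sA (nth_slot i)).
Definition wB (w : arrow Qd -> nat) i : nat := w (bwd_arrow (nth_slot i)).

Lemma wAB i : (wA ord_wt i + wB ord_wt i)%N = Xord i.
Proof. by rewrite -wX_ord wX_AB. Qed.

Lemma XiE i : Xi i = Ai i * Bi i. Proof. exact: eX_AB. Qed.

Lemma filt_Ai w i : filt w (wA w i) (Ai i). Proof. exact: filt_mon. Qed.
Lemma filt_Bi w i : filt w (wB w i) (Bi i).
Proof. by apply: filt_mon; rewrite wts_cons addn0. Qed.
Lemma filt_Xi i : ord_filt (Xord i) (Xi i).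
Proof. by apply: filt_mon; rewrite -wX_ord. Qed.
Lemma filt_Xi' i : ord_filt (Xord i) (Xi' i).
Proof. by rewrite /Xi'; apply: (filtM _ (@filt_Bi ord_wt i) (@filt_Ai ord_wt i)); rewrite addnC wAB. Qed.

Lemma Xnext_succ i j : j = i.+1 :> nat -> Xnext i = Xi j.
Proof.
move=> e; rewrite /Xnext (bigD1 j) /= ?e // big1 ?addr0 // => k /andP[/eqP ek].
by rewrite -(inj_eq (@ord_inj _)) ek e eqxx.
Qed.

Lemma parallel_Bi i : parallel (tgt (nth_slot i)) (src (nth_slot i)) (Bi i).
Proof. by apply: parallel_mon. Qed.

(** ** Power series in the [x_i] *)

Implicit Types (ka de : 'I_nslots -> nat -> K).

Definition powers ka N : A := \sum_(i < nslots) \sum_(2 <= j < N) ka i j *: Xi i ^+ j.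

(** The power series [sum ka i j x_i^j] over [j >= 2]: since [x_i^j] has no term
    of length below [j], finitely many summands give the coefficient at [p]. *)
Definition Vpow ka : A := CPathAlg (fun p => powers ka (plen p).+1 p).

Lemma adic_Xi i d : in_adic d (Xi i ^+ d).
Proof.
apply/in_adicE; rewrite -[d in filt _ d]muln1; apply: filtX; apply: filt_mon.
by rewrite wts1 /sX size_rcons.
Qed.

Lemma powers_stable ka N p : (plen p < N)%N -> powers ka N p = powers ka (plen p).+1 p.
Proof.
move=> lt; rewrite /powers !coef_bigsum; apply: eq_bigr => i _; rewrite !coef_bigsum.
rewrite [RHS](big_nat_widen _ _ _ _ _ lt) [RHS]big_mkcond; apply: eq_bigr => j _.
rewrite andTb ltnS; case: leqP => // l.
by rewrite coef_scale (adic_Xi i l) mulr0.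
Qed.

Lemma Vpow_powers ka N : in_adic N (Vpow ka - powers ka N).
Proof. by move=> p lt; rewrite coef_add coef_opp (powers_stable ka lt) subrr. Qed.

Lemma VpowD ka de : Vpow (fun i d => ka i d + de i d) = Vpow ka + Vpow de.
Proof.
apply: cpath_algP => p; rewrite coef_add /= /powers !coef_bigsum -big_split.
apply: eq_bigr => i _; rewrite !coef_bigsum -big_split.
by apply: eq_bigr => j _; rewrite !coef_scale mulrDl.
Qed.

Lemma VpowZ x ka : Vpow (fun i d => x * ka i d) = x *: Vpow ka.
Proof.
apply: cpath_algP => p; rewrite coef_scale /= /powers !coef_bigsum big_distrr.
apply: eq_bigr => i _; rewrite !coef_bigsum big_distrr.
by apply: eq_bigr => j _; rewrite !coef_scale -mulrA.
Qed.

Lemma Vpow0 : Vpow (fun _ _ => 0) = 0.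
Proof.
have := VpowZ 0 (fun _ _ => 0); rewrite scale0r => <-; congr Vpow.
by apply: funext => i; apply: funext => j; rewrite mulr0.
Qed.

Lemma powers_filt ka N B :
  (forall i d, (2 <= d)%N -> ka i d != 0 -> (B <= d * Xord i)%N) -> ord_filt B (powers ka N).
Proof.
move=> h; apply: filt_sum => i _; rewrite big_seq; apply: filt_sum => j.
rewrite mem_index_iota => /andP[l _].
case: (ka i j =P 0) => [->|/eqP /(h _ _ l) lB]; first by rewrite scale0r.
by apply: filtZ; apply: filt_le lB _; apply: filtX; apply: filt_Xi.
Qed.

Lemma Vpow_filt ka B :
  (forall i d, (2 <= d)%N -> ka i d != 0 -> (B <= d * Xord i)%N) -> ord_filt B (Vpow ka).
Proof. by move=> h p lt; apply: (powers_filt _ h). Qed.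

Lemma Vpow_concentrated ka d : (2 <= d)%N -> (forall i e, e != d -> ka i e = 0) ->
  Vpow ka = \sum_(i < nslots) ka i d *: Xi i ^+ d.
Proof.
move=> d2 h; apply: cpath_algP => p.
rewrite -[LHS]/(powers ka (plen p).+1 p) -(@powers_stable ka (d + plen p).+1); last by lia.
rewrite /powers !coef_bigsum; apply: eq_bigr => i _; rewrite coef_bigsum.
have dN : d \in index_iota 2 (d + plen p).+1 by rewrite mem_index_iota; lia.
rewrite (bigD1_seq d dN) ?iota_uniq //=.
by rewrite big1 ?addr0 // => j /(h i) ->; rewrite mul0r.
Qed.

Lemma Vpow_single i d : (2 <= d)%N ->
  Vpow (fun i' e => ((i' == i) && (e == d))%:R) = Xi i ^+ d.
Proof.
move=> d2; rewrite (Vpow_concentrated d2) => [|i' e /negbTE ->]; last by rewrite andbF.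
rewrite (bigD1 i) //= !eqxx scale1r big1 ?addr0 // => k /negbTE ->.
by rewrite scale0r.
Qed.

(** ** Substitutions of the arrows [B_i] *)

Lemma bwd_arrow_inj : injective (fun i => bwd_arrow (nth_slot i)).
Proof.
move=> i j /(congr1 val) /= [e1 e2]; apply: nth_slot_inj; apply: val_inj.
by rewrite [LHS]surjective_pairing [RHS]surjective_pairing e1 e2.
Qed.

(** Backward arrows and loops do not increase the vertex, forward ones do. *)
Lemma bwd_neq_fwd c i : ~~ is_loop I (val c) -> bwd_arrow (nth_slot i) != fwd_arrow c.
Proof.
move=> l; apply/eqP => /(congr1 val) e.
have {}e : val c = (tgt (nth_slot i), src (nth_slot i)) := esym e.
case: (slotP c) => [[+ _]|[_ _]]; last by rewrite (negbTE l).
rewrite e => h; have {}h : src (nth_slot i) = (tgt (nth_slot i)).+1 :> nat := h.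
by case: (slotP (nth_slot i)) => [[h' _]|[/(congr1 (@nat_of_ord n)) h' _ _]]; lia.
Qed.

Section SlotSubstitution.
Variables (ze : 'I_nslots -> A).
Hypothesis zeP : forall i, parallel (tgt (nth_slot i)) (src (nth_slot i)) (ze i).

Definition slot_img a : A :=
  if [pick i | bwd_arrow (nth_slot i) == a] is Some i then ze i else mon (tl a) [:: a].

Lemma slot_imgP a : parallel (tl a) (hd a) (slot_img a).
Proof.
rewrite /slot_img; case: pickP => [i /eqP <-|_]; first exact: zeP.
exact: parallel_mon.
Qed.

Definition slotsub : substitution K Qd := Substitution slot_imgP.

Lemma slot_img_bwd i : slot_img (bwd_arrow (nth_slot i)) = ze i.
Proof.
rewrite /slot_img; case: pickP => [j /eqP/bwd_arrow_inj -> //|/(_ i)].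
by rewrite eqxx.
Qed.

Lemma slot_img_other a : (forall i, bwd_arrow (nth_slot i) != a) -> slot_img a = mon (tl a) [:: a].
Proof. by move=> h; rewrite /slot_img; case: pickP => // i; rewrite (negbTE (h i)). Qed.

Lemma sub_Bi i : sub slotsub (Bi i) = ze i.
Proof.
rewrite /Bi /eB sub_mon /= ?eqxx //.
rewrite -[X in star _ X]/(tl (bwd_arrow (nth_slot i))) star_cons star_nil.
by rewrite [slotsub _]slot_img_bwd (parallel_idr (@zeP i)).
Qed.

Lemma sub_Ai i : sub slotsub (Ai i) = Ai i.
Proof.
rewrite /Ai /eA sub_mon ?composable_sA // /sA; case: ifP => [_|/negbT l].
  by rewrite star_nil.
rewrite -[X in star _ X]/(tl (fwd_arrow (nth_slot i))) star_cons star_nil.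
rewrite [slotsub _]slot_img_other => [|k]; last exact: bwd_neq_fwd.
by rewrite mon_mul eqxx.
Qed.

Lemma sub_Xi i : sub slotsub (Xi i) = Ai i * ze i.
Proof. by rewrite XiE sub_mul sub_Ai sub_Bi. Qed.

Lemma sub_Xi' i : sub slotsub (Xi' i) = ze i * Ai i.
Proof. by rewrite sub_mul sub_Ai sub_Bi. Qed.

Lemma slotsub_bounded w : (forall i, filt w (wB w i) (ze i)) -> bounded w slotsub.
Proof.
move=> h a; rewrite /= /slot_img; case: pickP => [i /eqP <-|_]; first exact: h.
by apply: filt_mon; rewrite wts_cons addn0.
Qed.

Lemma slotsub_unipotent w d :
  (forall i, filt w (wB w i + d) (ze i - Bi i)) -> unipotent w d slotsub.
Proof.
move=> h a; rewrite /= /slot_img; case: pickP => [i /eqP <-|_]; first exact: h.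
by rewrite subrr.
Qed.

End SlotSubstitution.

End Weights.

(** * Removing the words of one weight *)

Section Step.
Variables (K : fieldType) (n : nat) (I : {set 'I_n}).
Notation Qd := (double_quiver I).
Notation nslots := (nslots I).
Notation nth_slot := (@nth_slot n I).
Notation src c := ((val c).1 : vertex Qd).
Notation tgt c := ((val c).2 : vertex Qd).
Notation A := (cpath_alg K Qd).
Notation ord_filt := (@filt K Qd (@ord_wt n I)).
Notation ord_wt := (@ord_wt n I).
Notation Xi := (@Xi n I K).
Notation Xi' := (@Xi' n I K).
Notation Ai := (@Ai n I K).
Notation Bi := (@Bi n I K).
Notation Xnext := (@Xnext n I K).
Notation base_potential := (@base_potential n I K).
Implicit Types (i j : 'I_nslots) (a : arrow Qd) (f g h : A) (ka de : 'I_nslots -> nat -> K).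
Implicit Types (N d : nat) (eta : 'I_nslots -> A).

Definition slot_parallel eta :=
  forall i, parallel (tgt (nth_slot i)) (src (nth_slot i)) (eta i).

(** As [x_(i+1)] is lighter than [x_i] by at least 2, a path [eta_i] in a word
    [A_i x_(i+1) eta_i] of weight [N] is at least this heavy; the excess of 2 over
    [N - wA i - Xord i] is what pushes all side effects beyond weight [N]. *)
Definition level_bounded N eta := forall i, ord_filt (N + 2 - (wA ord_wt i + Xord i)) (eta i).

(** What the part of weight [N] of a series looks like up to cyclic
    equivalence: powers of the [x_i] of weight [N], and words
    [A_i x_(i+1) eta_i] that the substitution [B_i - eta_i] will cancel. *)
Definition level_form N h := exists de eta,
  [/\ forall i d, de i d != 0 -> (d * Xord i = N)%N, slot_parallel eta, level_bounded N eta
    & cyc_equiv h (Vpow de + \sum_(i < nslots) Ai i * Xnext i * eta i)].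

Lemma level_cyc N f g : cyc_equiv f g -> level_form N g -> level_form N f.
Proof.
move=> e [de [eta [h1 h2 h3 h4]]]; exists de, eta; split=> //.
exact: cyc_trans h4.
Qed.

Lemma level0 N : level_form N 0.
Proof.
exists (fun _ _ => 0), (fun=> 0); split=> [i d|i|i|].
- by rewrite eqxx.
- exact: parallel0.
- exact: filt_0.
by rewrite Vpow0 big1 ?addr0 => [|i _]; [apply: cyc_refl|rewrite mulr0].
Qed.

Lemma levelD N f g : level_form N f -> level_form N g -> level_form N (f + g).
Proof.
case=> [de [eta [h1 h2 h3 h4]]] [de' [eta' [h1' h2' h3' h4']]].
exists (fun i d => de i d + de' i d), (fun i => eta i + eta' i); split=> [i d|i|i|].
- case: (de i d =P 0) => [->|/eqP /h1 //]; rewrite add0r; exact: h1'.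
- exact: parallelD.
- exact: filtD.
rewrite VpowD; under eq_bigr do rewrite mulrDr.
by rewrite big_split addrACA; apply: cyc_add.
Qed.

Lemma levelZ N x f : level_form N f -> level_form N (x *: f).
Proof.
case=> [de [eta [h1 h2 h3 h4]]].
exists (fun i d => x * de i d), (fun i => x *: eta i); split=> [i d|i|i|].
- by rewrite mulf_eq0 negb_or => /andP[_ /h1].
- exact: parallelZ.
- exact: filtZ.
rewrite VpowZ; under eq_bigr do rewrite -scaleAr.
by rewrite -scaler_sumr -scalerDr; apply: cyc_scale.
Qed.

Lemma cyc_sum_single (F : 'I_nslots -> A) i : (forall k, k != i -> F k = 0) ->
  \sum_(k < nslots) F k = F i.
Proof. by move=> h; rewrite (bigD1 i) //= big1 ?addr0. Qed.

(** The bound on [N] excludes the first powers of the [x_i]. *)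
Lemma level_mon N (p : qpath Qd) : (22 * n < N)%N -> wt ord_wt p = N -> level_form N (monom K p).
Proof.
move=> lN wN; rewrite monE; set v := psource p; set s := parrows p.
have cs : composable v s by apply: (svalP p).
have ws : wts ord_wt s = N by [].
case: (boolP (endpoint v s == v)) => [/eqP es|ne]; last first.
  by apply: level_cyc (level0 N); apply: cyc_nonclosed.
have ns : s != [::] by apply/eqP => e; move: ws lN; rewrite e wts_nil => <-; lia.
case: (cyclic_shapeP K ns cs es) => [i d d0 e W|i j t ij ct et t0 e W].
  have du : (d * Xord i)%N = N by rewrite -ws W wX_ord.
  have d2 : (2 <= d)%N.
    by case: d d0 du {e W} => [|[|d]] // _; have := Xord_bound i; lia.
  exists (fun i' e => ((i' == i) && (e == d))%:R), (fun=> 0); split=> [k m|k|k|].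
  - by case: (k =P i) => [->|_]; case: (m =P d) => [->|_]; rewrite /= ?eqxx.
  - exact: parallel0.
  - exact: filt_0.
  rewrite Vpow_single // big1 ?addr0 => [//|k _]; by rewrite mulr0.
pose eta k : A := if k == i then mon (tgt (nth_slot i)) t else 0.
exists (fun _ _ => 0), eta; split=> [k m|k|k|].
- by rewrite eqxx.
- by rewrite /eta; case: eqP => [->|_]; [apply: parallel_mon|apply: parallel0].
- rewrite /eta; case: eqP => [->|_]; last exact: filt_0.
  apply: filt_mon; have := W ord_wt; rewrite ws wX_ord -/(wA ord_wt i).
  by have := @Xord_succ n I i j; rewrite ij ltnSn => /(_ isT); lia.
rewrite Vpow0 add0r (cyc_sum_single (i := i)) => [|k /negbTE ne]; last first.
  by rewrite /eta ne mulr0.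
by rewrite /eta eqxx (Xnext_succ _ ij).
Qed.

(** Take for [L] the part of [h] of weight exactly [N], a finite sum. *)
Lemma level_split N h : (22 * n < N)%N -> ord_filt N h ->
  exists2 L, level_form N L & ord_filt N.+1 (h - L).
Proof.
move=> lN hN; exists (\sum_(q <- paths_upto Qd N | wt ord_wt q == N) h q *: monom K q).
  elim/big_ind: _ => [|f g|q /eqP wq]; [exact: level0|exact: levelD|].
  by apply: levelZ; apply: level_mon.
move=> p; rewrite ltnS leq_eqVlt coef_add coef_opp (sum_monom (fun q => wt ord_wt q == N)).
case: eqP => [e _|/eqP ne /= lt].
  rewrite ifT ?subrr //= -e; apply: wts_size => a.
  by have /andP[] := ord_wt_bound a.
by rewrite hN // subr0.
Qed.

Section Killing.
Variables (N : nat) (eta : 'I_nslots -> A).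
Hypotheses (n0 : (0 < n)%N) (lN : (44 * n < N)%N).
Hypotheses (etaP : slot_parallel eta) (etaF : level_bounded N eta).

Lemma kill_parallel : slot_parallel (fun i => Bi i - eta i).
Proof. by move=> i; apply: parallelD; [apply: parallel_Bi|apply: parallelN]. Qed.

Definition kill : substitution K Qd := slotsub kill_parallel.

Lemma kill_unipotent : unipotent ord_wt (N - 44 * n) kill.
Proof.
apply: slotsub_unipotent => i; rewrite addrAC subrr add0r; apply: filtN.
apply: filt_le (@etaF i); have := Xord_bound i; have := @wAB n I i; lia.
Qed.

Lemma filt_Aeta i : ord_filt (N + 2 - Xord i) (Ai i * eta i).
Proof. by apply: (filtM _ (@filt_Ai n I K ord_wt i) (@etaF i)); lia. Qed.

Lemma filt_etaA i : ord_filt (N + 2 - Xord i) (eta i * Ai i).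
Proof. by apply: (filtM _ (@etaF i) (@filt_Ai n I K ord_wt i)); lia. Qed.

Definition dnext i : A := \sum_(j < nslots | j == i.+1 :> nat) Ai j * eta j.

Lemma filt_dnext i : ord_filt (N + 2 - Xord i) (dnext i).
Proof.
apply: filt_sum => j /eqP e; apply: filt_le (@filt_Aeta j).
by have := @Xord_succ n I i j; rewrite e ltnSn => /(_ isT); lia.
Qed.

Lemma kill_Xi i : sub kill (Xi i) = Xi i - Ai i * eta i.
Proof. by rewrite sub_Xi XiE mulrBr. Qed.

Lemma kill_Xi' i : sub kill (Xi' i) = Xi' i - eta i * Ai i.
Proof. by rewrite sub_Xi' mulrBl. Qed.

Lemma kill_Xnext i : sub kill (Xnext i) = Xnext i - dnext i.
Proof. by rewrite sub_sum -sumrB; apply: eq_bigr => j _; rewrite kill_Xi. Qed.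

(** Besides the intended [- eta_i A_i x_(i+1)], the term [x_i' x_(i+1)] yields
    [- x_i' A_(i+1) eta_(i+1)], heavier than [N] because [x_i] is heavier than
    [x_(i+2)], and a product of two perturbations, which is heavier still. *)
Lemma kill_base :
  ord_filt N.+1 (sub kill base_potential - base_potential + \sum_(i < nslots) eta i * Ai i * Xnext i).
Proof.
rewrite sub_sum -sumrB -big_split; apply: filt_sum => i _.
rewrite sub_mul kill_Xi' kill_Xnext /=.
have -> : forall x e y d : A, (x - e) * (y - d) - x * y + e * y = e * d - x * d.
  move=> x e y d; rewrite mulrBl !mulrBr; apply: cpath_algP => p.
  by rewrite !coef_lin; ring.
have ub := Xord_bound i; apply: filtB.
  by apply: (filtM _ (@filt_etaA i) (@filt_dnext i)); lia.
by apply: (filtM _ (@filt_Xi' n I K i) (@filt_dnext i)); lia.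
Qed.

(** The cross terms are heavier than [N] since [x_i] is heavier than
    [x_(i+1)]. *)
Lemma kill_square i : ord_filt N.+1 (sub kill (Xi i ^+ 2) - Xi i ^+ 2).
Proof.
rewrite sub_exp kill_Xi; set e := Ai i * eta i; set x := Xi i.
have -> : (x - e) ^+ 2 - x ^+ 2 = e * e - x * e - e * x.
  rewrite !expr2 mulrBl !mulrBr; apply: cpath_algP => p.
  by rewrite !coef_lin; ring.
have ub := Xord_bound i; have fe := @filt_Aeta i; have fx := @filt_Xi n I K i.
apply: filtB; first apply: filtB.
- by apply: (filtM _ fe fe); lia.
- by apply: (filtM _ fx fe); lia.
by apply: (filtM _ fe fx); lia.
Qed.

(** Squares are handled exactly; the powers from the third on are so heavy that
    any perturbation of them is beyond weight [N]. *)
Lemma kill_Vpow ka : ord_filt N.+1 (sub kill (Vpow ka) - Vpow ka).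
Proof.
pose k2 i d := if d == 2%N then ka i d else 0.
pose k3 i d := if d == 2%N then 0 else ka i d.
have -> : Vpow ka = Vpow k2 + Vpow k3.
  rewrite -VpowD; congr Vpow; apply: funext => i; apply: funext => d.
  by rewrite /k2 /k3; case: ifP; rewrite ?addr0 ?add0r.
rewrite subD opprD addrACA; apply: filtD.
  rewrite (@Vpow_concentrated _ _ _ _ 2) // => [|i d /negbTE]; last by rewrite /k2 => ->.
  rewrite sub_sum -sumrB; apply: filt_sum => i _.
  by rewrite subZ -scalerBr; apply: filtZ; apply: kill_square.
apply: filt_le (sub_unipotent kill_unipotent (@Vpow_filt n I K k3 (45 * n) _)).
  by lia.
move=> i d d2; rewrite /k3; case: (d =P 2%N) => [_|ne _]; first by rewrite eqxx.
have /andP[ub _] := Xord_bound i; have d3 : (3 <= d)%N by lia.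
by apply: leq_trans (leq_mul d3 (leqnn _)); lia.
Qed.

End Killing.

(** The lightest part of [h] is, up to cyclic equivalence, a combination of
    powers, which join [ka], and of words that the substitution cancels against
    its effect on [base_potential]. *)
Lemma kill_level N ka f h : (0 < n)%N -> (44 * n < N)%N -> ord_filt N h ->
  cyc_equiv f (base_potential + Vpow ka + h) ->
  exists (th : substitution K Qd) ka' h',
    [/\ unipotent ord_wt (N - 44 * n) th,
        forall i d, ka' i d = ka i d \/ (d * Xord i = N)%N,
        ord_filt N.+1 h' & cyc_equiv (sub th f) (base_potential + Vpow ka' + h')].
Proof.
move=> n0 lN hN ef.
have [|L [de [eta [dP etaP etaF eL]]] hL] := level_split _ hN; first by lia.
exists (kill etaP), (fun i d => ka i d + de i d).
pose S := \sum_(i < nslots) eta i * Ai i * Xnext i.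
have eL' : cyc_equiv L (Vpow de + S).
  apply: cyc_trans eL _; apply: cyc_add; first exact: cyc_refl.
  by apply: cyc_sum => i _; rewrite -[X in cyc_equiv _ X]mulrA; apply: cyc_comm.
exists ((sub (kill etaP) base_potential - base_potential + S) + (sub (kill etaP) (Vpow ka) - Vpow ka)
        + (sub (kill etaP) h - h) + (h - L)).
split.
- exact: kill_unipotent.
- move=> i d; case: (de i d =P 0) => [->|/eqP/dP]; first by left; rewrite addr0.
  by right.
- apply: filtD => //; apply: filtD.
    by apply: filtD; [apply: kill_base|apply: kill_Vpow].
  by apply: filt_le (sub_unipotent (kill_unipotent n0 lN etaP etaF) hN); lia.
apply: cyc_trans (sub_cyc _ ef) _; rewrite !subD VpowD.
rewrite /cyc_equiv; set b := sub _ base_potential; set V := sub _ (Vpow ka); set H := sub _ h.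
have -> : b + V + H - (base_potential + (Vpow ka + Vpow de) + (b - base_potential + S + (V - Vpow ka) + (H - h) + (h - L)))
  = L - (Vpow de + S).
  by apply: cpath_algP => p; rewrite !coef_lin; ring.
exact: eL'.
Qed.

End Step.

(** * The quadratic part *)

Section Quadratic.
Variables (K : fieldType) (n : nat) (I : {set 'I_n}).
Notation Qd := (double_quiver I).
Notation slot := (slot I).
Notation nslots := (nslots I).
Notation nth_slot := (@nth_slot n I).
Notation tl a := (@qtail Qd a).
Notation hd a := (@qhead Qd a).
Notation src c := ((val c).1 : vertex Qd).
Notation tgt c := ((val c).2 : vertex Qd).
Notation A := (cpath_alg K Qd).
Notation deg_wt := (@deg_wt n I).
Notation deg_filt := (@filt K Qd deg_wt).
Notation Xi := (@Xi n I K).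
Notation Xi' := (@Xi' n I K).
Notation Ai := (@Ai n I K).
Notation Bi := (@Bi n I K).
Notation Xnext := (@Xnext n I K).
Notation loop i := (is_loop I (val (nth_slot i))).
Implicit Types (i j k l : 'I_nslots) (a b : arrow Qd) (f g h : A) (ka la mu : 'I_nslots -> K).

Definition Xprev i : A := \sum_(k < nslots | i == k.+1 :> nat) Xi' k.

Lemma Xprev_succ i k : i = k.+1 :> nat -> Xprev i = Xi' k.
Proof.
move=> e; rewrite /Xprev (bigD1 k) /= ?e // big1 ?addr0 // => l /andP[/eqP el].
by rewrite -(inj_eq (@ord_inj _)); move: el => [->]; rewrite eqxx.
Qed.

Lemma meet i j : j = i.+1 :> nat -> tgt (nth_slot i) = src (nth_slot j).
Proof. exact: nth_slot_meet. Qed.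

Lemma loop_eq i : loop i -> src (nth_slot i) = tgt (nth_slot i).
Proof. by case/andP => /eqP. Qed.

Lemma loop_succ i j : j = i.+1 :> nat -> loop i -> ~~ loop j.
Proof.
move=> ij li; apply/negP => lj; have ni : nth_slot i = nth_slot j.
  apply: val_inj; rewrite [LHS]surjective_pairing [RHS]surjective_pairing.
  by congr pair; rewrite -?(loop_eq lj) -?(loop_eq li) -(meet ij) (loop_eq li).
by move: ij; rewrite (nth_slot_inj ni) => h; have := n_Sn _ h.
Qed.

Lemma parallel_Xi' i : parallel (tgt (nth_slot i)) (tgt (nth_slot i)) (Xi' i).
Proof.
rewrite /Xi' /Bi /Ai /eB /eA mon_mul endpoint_cons eqxx; apply: parallel_mon => //.
by rewrite endpoint_cat endpoint_sA.
Qed.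

Lemma Ai_loop i : loop i -> Ai i = mon (tgt (nth_slot i)) [::].
Proof. by move=> li; rewrite /Ai /eA /sA li (loop_eq li). Qed.

Lemma Ai_Xi i j : loop i -> j = i.+1 :> nat -> Ai i * Xi j = Xi j.
Proof. by move=> li ij; rewrite (Ai_loop li) (meet ij) /Xi /eX mon_mul eqxx. Qed.

Lemma Ai_Xnext i : loop i -> Ai i * Xnext i = Xnext i.
Proof. by move=> li; rewrite mulr_sumr; apply: eq_bigr => j /eqP ij; apply: Ai_Xi. Qed.

(** The only words of degree 4, up to rotation, that are neither [x_i^2] nor
    [x_i' x_(i+1)]: those that step over a loop without using it. *)
Definition Yi i : A := if loop i then Xprev i * Xnext i else 0.

Definition quad ka la mu : A := \sum_(i < nslots)
  (ka i *: Xi i ^+ 2 + la i *: (Xi' i * Xnext i) + mu i *: Yi i).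

Lemma quadD ka la mu ka' la' mu' :
  quad (fun i => ka i + ka' i) (fun i => la i + la' i) (fun i => mu i + mu' i) =
  quad ka la mu + quad ka' la' mu'.
Proof.
rewrite -big_split; apply: eq_bigr => i _ /=; rewrite !scalerDl.
by apply: cpath_algP => p; rewrite !coef_add; ring.
Qed.

Lemma quadZ x ka la mu :
  quad (fun i => x * ka i) (fun i => x * la i) (fun i => x * mu i) = x *: quad ka la mu.
Proof.
rewrite scaler_sumr; apply: eq_bigr => i _.
by rewrite !scalerDr !scalerA.
Qed.

(** Squares of loops have length 2 and do not occur in reduced potentials; they
    are excluded because straightening would not leave them invariant. *)
Definition quad_form f := exists ka la mu,
  (forall i, loop i -> ka i = 0) /\ cyc_equiv f (quad ka la mu).

Lemma quad_form0 : quad_form 0.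
Proof.
exists (fun=> 0), (fun=> 0), (fun=> 0); split=> //; rewrite /quad big1; first exact: cyc_refl.
by move=> i _; rewrite !scale0r !addr0.
Qed.

Lemma quad_formD f g : quad_form f -> quad_form g -> quad_form (f + g).
Proof.
case=> [ka [la [mu [z e]]]] [ka' [la' [mu' [z' e']]]].
exists (fun i => ka i + ka' i), (fun i => la i + la' i), (fun i => mu i + mu' i).
by split=> [i li|]; rewrite ?z ?z' ?addr0 // quadD; apply: cyc_add.
Qed.

Lemma quad_formZ x f : quad_form f -> quad_form (x *: f).
Proof.
case=> [ka [la [mu [z e]]]].
exists (fun i => x * ka i), (fun i => x * la i), (fun i => x * mu i).
by split=> [i li|]; rewrite ?z ?mulr0 // quadZ; apply: cyc_scale.
Qed.

Lemma quad_single i (x y z : K) : quad (fun k => x *+ (k == i)) (fun k => y *+ (k == i))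
   (fun k => z *+ (k == i)) = x *: Xi i ^+ 2 + y *: (Xi' i * Xnext i) + z *: Yi i.
Proof.
rewrite /quad (bigD1 i) //= eqxx !mulr1n big1 ?addr0 // => k /negbTE ->.
by rewrite !mulr0n !scale0r !addr0.
Qed.

Lemma single_walk (v w : vertex Qd) (t : seq (arrow Qd)) : composable v t -> endpoint v t = w ->
  size t = 1%N -> exists a, [/\ t = [:: a], tl a = v & hd a = w].
Proof.
case: t => // a [] // + + _; rewrite composable_cons endpoint_cons => /andP[/eqP ta _] ea.
by exists a; split.
Qed.

(** In a word [A_i x_(i+1) p] of degree at most 4, the path [p] is at most as long
    as the degree of [B_i] allows: it is [B_i] itself or, if [B_i] is a loop, it
    can also be one of the two excursions [x_(i+1)] and [x_(i-1)'] from its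
    vertex. *)
Lemma quad_form_monom (p : qpath Qd) : pclosed p -> (3 <= plen p)%N -> (wt deg_wt p <= 4)%N ->
  quad_form (monom K p).
Proof.
move=> cp lp wp; rewrite monE; set v := psource p; set s := parrows p.
have cs : composable v s by apply: (svalP p).
have es : endpoint v s = v by apply/eqP.
have ns : s != [::] by apply/eqP => e; move: lp; rewrite /plen -/s e.
have ws : (wts deg_wt s <= 4)%N := wp.
have ls : (3 <= size s)%N := lp.
have lw : (size s <= wts deg_wt s)%N by apply: wts_size => a; have /andP[] := deg_wt_bound a.
have one i : cyc_equiv (mon v s : A) (Xi' i * Xnext i) -> quad_form (mon v s).
  move=> e; exists (fun k => 0 *+ (k == i)), (fun k => 1 *+ (k == i)), (fun k => 0 *+ (k == i)).
  split=> [k _|]; first by rewrite mul0rn.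
  by rewrite quad_single !scale0r add0r addr0 scale1r.
case: (cyclic_shapeP K ns cs es) => [i d d0 e W|i j t ij ct et t0 e W].
  have wd := W deg_wt; rewrite wX_deg in wd; have d2 : d = 2%N by lia.
  exists (fun k => 1 *+ (k == i)), (fun k => 0 *+ (k == i)), (fun k => 0 *+ (k == i)).
  split=> [k lk|]; last by rewrite quad_single !scale0r !addr0 scale1r -d2.
  case: (k =P i) => // ki; move: ls; have := W (fun=> 1%N); rewrite wts1 d2 wX_AB /sA -ki lk.
  by rewrite wts_nil => ->.
have wt_t := W deg_wt; rewrite wX_deg in wt_t.
have lt : (size t <= wts deg_wt t)%N by apply: wts_size => a; have /andP[] := deg_wt_bound a.
(* a single arrow parallel to [B_i] is [B_i] *)
have S1 : size t = 1%N -> quad_form (mon v s).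
  move=> sz; have [a [ta tla hda]] := single_walk ct et sz.
  have ea : a = bwd_arrow (nth_slot i) by apply: arrow_inj.
  apply: (one i); apply: cyc_trans e _; rewrite ta ea (Xnext_succ _ ij) /Xi'.
  by rewrite -[X in cyc_equiv _ X]mulrA; apply: cyc_comm.
case li : (loop i); last first.
  by apply: S1; move: wt_t; rewrite /sA li wts_cons wts_nil deg_wt_fwd ?li //; lia.
case: (size t =P 1%N) => // s1; have s2 : size t = 2%N.
  by move: wt_t; rewrite /sA li wts_nil; lia.
case: t ct et {lt t0 S1 s1} e W wt_t s2 => [|a [|b []]] // ct et e W wt_t _.
have vi := loop_eq li.
move: ct et; rewrite !composable_cons !endpoint_cons => /and3P[/eqP ta /eqP tb _] hb.
have {}hb : hd b = src (nth_slot i) := hb.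
have ki : key (nth_slot i) = (src (nth_slot i) + src (nth_slot i))%N by rewrite /key -vi.
have la1 : deg_wt a = 1%N.
  by move: wt_t; rewrite /sA li !wts_cons !wts_nil; have := deg_wt_bound a; have := deg_wt_bound b; lia.
have tb' : tl b = hd a by [].
have nla : tl a != hd a.
  apply/eqP => h; have L : is_loop I (tl a, hd a).
    rewrite -h ta -vi; apply/andP; split; first exact: eqxx.
    by case/andP: li.
  by move: la1; rewrite /deg_wt L.
have tan : tl a = src (nth_slot i) :> nat by rewrite ta vi.
have hbn : hd b = src (nth_slot i) :> nat by rewrite hb.
have eAX : Ai i * Xi j = Xi j := Ai_Xi li ij.
case: (arrowP a) => [h|h|[h _]]; last by rewrite h eqxx in nla.
  have [k [ek fk nk kk]] := slot_of_fwd h.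
  have ik : k = i.+1 :> nat.
    by apply: nth_slot_succ; rewrite kk ki /akey; [lia|move=> c; lia].
  have kj : k = j by apply: ord_inj; rewrite ik ij.
  have bk : bwd_arrow (nth_slot k) = b by apply: arrow_inj; rewrite ?tb ?hb /= ek /= ?ta ?vi.
  exists (fun k => 1 *+ (k == j)), (fun k => 0 *+ (k == j)), (fun k => 0 *+ (k == j)).
  split=> [l ll|].
    by case: (l =P j) => // lj; move: ll nk; rewrite lj kj => ->.
  rewrite quad_single !scale0r !addr0 scale1r; apply: cyc_trans e _; apply: cyc_eq.
  rewrite -/(Ai i) -/(Xi j) eAX expr2; congr (_ * _).
  rewrite /Xi /eX /sX /sA -kj (negbTE nk) fk bk; congr mon.
  by rewrite ek -ta.
have hb2 : hd b = (tl b).+1 :> nat by rewrite tb' hbn -tan.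
have [k [ek fk nk kk]] := slot_of_fwd hb2.
have ik : i = k.+1 :> nat.
  by apply: nth_slot_succ; rewrite kk ki /akey tb'; [lia|move=> c; lia].
have T1 : tgt (nth_slot k) = hd b by rewrite ek.
have T2 : src (nth_slot k) = tl b by rewrite ek.
have bk : bwd_arrow (nth_slot k) = a.
  by apply: arrow_inj; [rewrite [LHS]T1 hb vi ta|rewrite [LHS]T2 tb'].
exists (fun k => 0 *+ (k == i)), (fun k => 0 *+ (k == i)), (fun k => 1 *+ (k == i)).
split=> [l _|]; first by rewrite mul0rn.
rewrite quad_single !scale0r !add0r scale1r; apply: cyc_trans e _.
rewrite -/(Ai i) -/(Xi j) eAX /Yi li (Xprev_succ ik) (Xnext_succ _ ij).
have -> : mon (tgt (nth_slot i)) [:: a; b] = Xi' k :> A; last exact: cyc_comm.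
rewrite /Xi' /Bi /Ai /eB /eA mon_mul endpoint_cons eqxx /sA (negbTE nk) fk bk; congr mon.
by rewrite -vi -hb T1.
Qed.

(** The rest has degree at least 5: a path of degree at most 4 has length at
    most 4, so the sum is complete. *)
Lemma quad_split f : potential f -> reduced f ->
  exists2 q, quad_form q & deg_filt 5 (f - q).
Proof.
move=> pf rf.
exists (\sum_(q <- paths_upto Qd 4 | (wt deg_wt q <= 4)%N) f q *: monom K q).
  elim/big_ind: _ => [|x y|q wq]; [exact: quad_form0|exact: quad_formD|].
  case: (f q =P 0) => [->|/eqP ne]; first by rewrite scale0r; apply: quad_form0.
  apply: quad_formZ; have /andP[cq lq] := pf _ ne; apply: quad_form_monom => //.
  by rewrite ltn_neqAle lq andbT eq_sym; apply/eqP => e; rewrite rf ?eqxx in ne.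
move=> p; rewrite ltnS => lt; rewrite coef_add coef_opp.
rewrite (sum_monom (fun q => wt deg_wt q <= 4)%N) ifT ?subrr // lt /=.
by apply: leq_trans lt; apply: wts_size => a; have /andP[] := deg_wt_bound a.
Qed.

(** Both are [A B A B] up to rotation. *)
Lemma cyc_square k : cyc_equiv (Xi k ^+ 2) (Xi' k * Xi' k).
Proof.
have -> : Xi k ^+ 2 = Ai k * (Bi k * (Ai k * Bi k)) by rewrite expr2 XiE !mulrA.
have -> : Xi' k * Xi' k = Bi k * (Ai k * Bi k) * Ai k by rewrite /Xi' !mulrA.
exact: cyc_comm.
Qed.

(** ** The coefficients of [x_i' x_(i+1)] *)

Lemma parrows_xpath k : parrows (xpath k) = sX (nth_slot k).
Proof.
rewrite /xpath parrows_pcomp ?target_slot_a ?source_slot_b // /sX /sA /slot_b.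
case: (slotP (nth_slot k)) => [[e /negbTE ->]|[e _ ->]] //=.
congr [:: _]; apply: val_inj => /=.
by rewrite [LHS]surjective_pairing e.
Qed.

Lemma parrows_xpath' k : parrows (xpath' k) = bwd_arrow (nth_slot k) :: sA (nth_slot k).
Proof.
rewrite /xpath' parrows_pcomp ?target_slot_b ?source_slot_a // /sA /slot_b.
case: (slotP (nth_slot k)) => [[e /negbTE ->]|[e _ ->]] //=.
congr [:: _]; apply: val_inj => /=.
by rewrite [LHS]surjective_pairing e.
Qed.

Lemma monom_xpathE k : monom K (xpath k) = Xi k.
Proof.
rewrite monE parrows_xpath /xpath psource_pcomp ?target_slot_a ?source_slot_b //.
Qed.

Lemma monom_xpath'E k : monom K (xpath' k) = Xi' k.
Proof.
rewrite monE parrows_xpath' /xpath' psource_pcomp ?target_slot_b ?source_slot_a //.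
by rewrite source_slot_b /Xi' /Bi /Ai /eB /eA mon_mul endpoint_cons eqxx.
Qed.

Lemma bwd_notin_sA i k : bwd_arrow (nth_slot i) \notin sA (nth_slot k).
Proof.
rewrite /sA; case: ifP => // /negbT l; rewrite inE; exact: bwd_neq_fwd.
Qed.

Lemma bwd_in_sX i k : (bwd_arrow (nth_slot i) \in sX (nth_slot k)) = (i == k).
Proof. by rewrite /sX mem_rcons inE (negbTE (bwd_notin_sA i k)) orbF (inj_eq (@bwd_arrow_inj n I)). Qed.

Section Trace.
Variables (i j : 'I_nslots).
Hypothesis ij : j = i.+1 :> nat.
Notation c := (pcomp (xpath' i) (xpath j)).

Let meet_c : ptarget (xpath' i) = psource (xpath j).
Proof. exact: xpath_meet. Qed.

Lemma parrows_c : parrows c = (bwd_arrow (nth_slot i) :: sA (nth_slot i)) ++ sX (nth_slot j).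
Proof. by rewrite parrows_pcomp // parrows_xpath' parrows_xpath. Qed.

Lemma closed_c : pclosed c.
Proof.
rewrite /pclosed ptarget_pcomp // psource_pcomp //.
rewrite /xpath ptarget_pcomp ?target_slot_a ?source_slot_b // target_slot_b.
rewrite /xpath' psource_pcomp ?target_slot_b ?source_slot_a // source_slot_b.
by rewrite (meet ij).
Qed.

Lemma pos_c : (0 < plen c)%N. Proof. by rewrite /plen parrows_c. Qed.

Lemma wt_c : wts deg_wt (parrows c) = 4%N.
Proof.
have e := wX_deg (nth_slot i); rewrite wX_AB in e.
by rewrite parrows_c wts_cat wts_cons -/(wX deg_wt (nth_slot j)) wX_deg; lia.
Qed.

Lemma trace_mon_missing (v : vertex Qd) s a : a \in parrows c -> a \notin s ->
  trace c (mon v s : A) = 0.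
Proof.
move=> ac as'; case: (boolP (composable v s)) => cs.
  by rewrite (mon_exist _ cs); exact: (trace_missing K closed_c pos_c ac).
by rewrite mon0 //; apply: trace_eq0 => p _; rewrite coef_zero.
Qed.

Lemma bi_c : bwd_arrow (nth_slot i) \in parrows c. Proof. by rewrite parrows_c mem_head. Qed.
Lemma bj_c : bwd_arrow (nth_slot j) \in parrows c.
Proof. by rewrite parrows_c mem_cat bwd_in_sX eqxx orbT. Qed.

(** The arrows [B_i] and [B_j] occur in [c], and each slot has its own [B]. *)
Lemma trace_XX k l : ~~ ((i \in [:: k; l]) && (j \in [:: k; l])) ->
  trace c (Xi' k * Xi l) = 0.
Proof.
rewrite /Xi' /Bi /Ai /eB /eA /Xi /eX mon_mul endpoint_cons eqxx mon_mul => h.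
case: ifP => _; last by apply: trace_eq0 => p _; rewrite coef_zero.
have M m : (bwd_arrow (nth_slot m) \in ([:: bwd_arrow (nth_slot k)] ++ sA (nth_slot k)) ++ sX (nth_slot l))
    = (m \in [:: k; l]).
  by rewrite !mem_cat !inE bwd_in_sX (negbTE (bwd_notin_sA m k)) orbF (inj_eq (@bwd_arrow_inj n I)).
case/nandP: h => h; [apply: (trace_mon_missing _ bi_c)|apply: (trace_mon_missing _ bj_c)];
  by rewrite M.
Qed.

Lemma trace_quad ka la mu : trace c (quad ka la mu) = la i.
Proof.
have nij : i != j by apply/eqP => e; move: ij; rewrite e => h; have := n_Sn _ h.
have Sq k : trace c (Xi k ^+ 2) = 0.
  have -> : trace c (Xi k ^+ 2) = trace c (Xi' k * Xi' k).
    exact: (trace_cyc closed_c pos_c (cyc_square k)).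
  rewrite /Xi' /Bi /Ai /eB /eA !mon_mul endpoint_cons eqxx mon_mul.
  case: ifP => _; last by apply: trace_eq0 => p _; rewrite coef_zero.
  have M m : (bwd_arrow (nth_slot m) \in ([:: bwd_arrow (nth_slot k)] ++ sA (nth_slot k)) ++
       ([:: bwd_arrow (nth_slot k)] ++ sA (nth_slot k))) = (m == k).
    by rewrite !mem_cat !inE (negbTE (bwd_notin_sA m k)) !orbF (inj_eq (@bwd_arrow_inj n I)) orbb.
  case: (i =P k) => [ik|/eqP ik]; last by apply: (trace_mon_missing _ bi_c); rewrite M.
  by apply: (trace_mon_missing _ bj_c); rewrite M -ik eq_sym.
have XN k : trace c (Xi' k * Xnext k) = (k == i)%:R.
  rewrite /Xnext mulr_sumr trace_sum.
  case: (k =P i) => [->|/eqP ki].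
    rewrite (bigD1 j) /= ?ij // big1 ?addr0; last first.
      move=> l /andP[/eqP el] /eqP ne; case: ne; apply: ord_inj; by rewrite el ij.
    have := trace_self K closed_c pos_c; suff -> : Xi' i * Xi j = monom K c by [].
    by rewrite -monom_xpathE -monom_xpath'E monomM meet_c eqxx.
  apply: big1 => l /eqP lk; apply: trace_XX; rewrite !inE.
  apply/negP => /andP[/orP[/eqP e|/eqP e]]; first by rewrite e eqxx in ki.
  move=> /orP[]/eqP e'; move: ij; rewrite e' e lk; lia.
have YN k : trace c (Yi k) = 0.
  rewrite /Yi; case: ifP => _; last by apply: trace_eq0 => p _; rewrite coef_zero.
  rewrite /Xprev mulr_suml trace_sum big1 // => k' /eqP ek.
  rewrite /Xnext mulr_sumr trace_sum big1 // => l /eqP el.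
  apply: trace_XX; rewrite !inE; apply/negP.
  by case/andP => /orP[]/eqP e /orP[]/eqP e'; move: ij el ek; rewrite e' e; lia.
rewrite /quad trace_sum (bigD1 i) //= big1 => [|k /negbTE ki]; rewrite !traceD !traceZ Sq XN YN.
  by rewrite eqxx !mulr0 mulr1 add0r !addr0.
by rewrite ki !mulr0 !addr0.
Qed.

(** The trace at [x_i' x_(i+1)] picks the coefficient [la i] on the right, since
    rotations of a word of degree 4 have degree 4, and it is nonzero on [f]. *)
Lemma quad_coef_neq0 f ka la mu h : contains f c -> deg_filt 5 h ->
  cyc_equiv f (quad ka la mu + h) -> la i != 0.
Proof.
move=> ct hh e; have := contains_trace closed_c pos_c ct.
rewrite (trace_cyc closed_c pos_c e) traceD trace_quad trace_eq0 ?addr0 //.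
move=> p /(rotP closed_c pos_c)[r _ er]; apply: hh.
by rewrite /wt er wts_rot wt_c.
Qed.

End Trace.

End Quadratic.

(** * Normalizing the quadratic part *)

Section Normalization.
Variables (K : fieldType) (n : nat) (I : {set 'I_n}).
Notation Qd := (double_quiver I).
Notation slot := (slot I).
Notation nslots := (nslots I).
Notation nth_slot := (@nth_slot n I).
Notation tl a := (@qtail Qd a).
Notation A := (cpath_alg K Qd).
Notation ord_wt := (@ord_wt n I).
Notation deg_wt := (@deg_wt n I).
Notation ord_filt := (@filt K Qd ord_wt).
Notation deg_filt := (@filt K Qd deg_wt).
Notation Xi := (@Xi n I K).
Notation Xi' := (@Xi' n I K).
Notation Ai := (@Ai n I K).
Notation Bi := (@Bi n I K).
Notation Xnext := (@Xnext n I K).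
Notation Xprev := (@Xprev K n I).
Notation Yi := (@Yi K n I).
Notation base_potential := (@base_potential n I K).
Notation loop i := (is_loop I (val (nth_slot i))).
Implicit Types (i j k l : 'I_nslots) (a b : arrow Qd) (f g h : A) (ka la mu : 'I_nslots -> K).

(** ** Rescaling *)

Section Scaling.
Variable t : nat -> K.

Lemma scale_parallel : slot_parallel (fun i => t i *: Bi i).
Proof. by move=> i; apply: parallelZ; apply: parallel_Bi. Qed.

Definition scaling : substitution K Qd := slotsub scale_parallel.

Lemma scaling_bounded w : bounded w scaling.
Proof. by apply: slotsub_bounded => i; apply: filtZ; apply: filt_Bi. Qed.

Lemma scaling_Xi i : sub scaling (Xi i) = t i *: Xi i.
Proof. by rewrite sub_Xi -scaleAr XiE. Qed.

Lemma scaling_Xi' i : sub scaling (Xi' i) = t i *: Xi' i.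
Proof. by rewrite sub_Xi' -scaleAl. Qed.

Lemma scaling_Xnext i : sub scaling (Xnext i) = t i.+1 *: Xnext i.
Proof.
rewrite sub_sum scaler_sumr; apply: eq_bigr => j /eqP e.
by rewrite scaling_Xi e.
Qed.

Lemma scaling_Xprev i : sub scaling (Xprev i) = t i.-1 *: Xprev i.
Proof.
rewrite sub_sum scaler_sumr; apply: eq_bigr => k /eqP e.
by rewrite scaling_Xi' e.
Qed.

Lemma scaling_quad ka la mu : sub scaling (quad ka la mu) =
  quad (fun i => ka i * (t i * t i)) (fun i => la i * (t i * t i.+1))
       (fun i => mu i * (t i.-1 * t i.+1)).
Proof.
rewrite sub_sum; apply: eq_bigr => i _; rewrite !subD !subZ sub_exp sub_mul.
rewrite scaling_Xi scaling_Xi' scaling_Xnext !expr2.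
congr (_ + _ + _); rewrite -?scaleAl -?scaleAr ?scalerA //.
rewrite /Yi; case: ifP => _; last by rewrite linear0 !scaler0.
by rewrite sub_mul scaling_Xprev scaling_Xnext -scaleAl -scaleAr !scalerA mulrA.
Qed.

End Scaling.

Lemma sub_ext (th et : substitution K Qd) : (forall a, th a = et a) -> sub th =1 sub et.
Proof.
move=> h f; apply: cpath_algP => p; rewrite !coef_subE; apply: eq_bigr => q _.
by congr (_ * _); rewrite /star; congr (coef (_ * _) _); apply: eq_bigr.
Qed.

(** Both composites fix every arrow. *)
Lemma scalingK (t t' : nat -> K) : (forall m, t m * t' m = 1) ->
  cancel (sub (scaling t)) (sub (scaling t')).
Proof.
move=> h f; rewrite -sub_scomp -[RHS]sub_sid; apply: sub_ext => a.
rewrite /= /slot_img; case: pickP => [i /eqP <-|no].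
  by rewrite subZ sub_Bi scalerA h scale1r.
rewrite sub_mon /= ?eqxx // -[X in star _ X]/(tl a) star_cons star_nil.
rewrite [scaling _ _]slot_img_other ?mon_mul ?eqxx // => k.
by apply/negP => e; have := no k; rewrite e.
Qed.

Lemma scaling_bij (t : nat -> K) : (forall m, t m != 0) -> bijective (sub (scaling t)).
Proof.
move=> t0; exists (sub (scaling (fun m => (t m)^-1))).
  by apply: scalingK => m; rewrite mulfV.
by apply: scalingK => m; rewrite mulVf.
Qed.

(** The solution of [s_k t_k t_(k+1) = 1] with [t_0 = 1]. *)
Fixpoint scale_factor (s : nat -> K) (m : nat) : K :=
  if m is m'.+1 then (s m' * scale_factor s m')^-1 else 1.

Lemma scale_factor_neq0 (s : nat -> K) m : (forall m, s m != 0) -> scale_factor s m != 0.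
Proof.
move=> h; elim: m => [|m IH] /=; first exact: oner_neq0.
by rewrite invr_eq0 mulf_neq0.
Qed.

Lemma quad_base ka la mu : (forall i j, j = i.+1 :> nat -> la i = 1) ->
  quad ka la mu = base_potential + \sum_(i < nslots) (ka i *: Xi i ^+ 2 + mu i *: Yi i).
Proof.
move=> h; rewrite -big_split; apply: eq_bigr => i _ /=.
rewrite [_ + la i *: _]addrC -addrA; congr (_ + _).
case: (pselect (exists j : 'I_nslots, j = i.+1 :> nat)) => [[j /h ->]|no].
  by rewrite scale1r.
rewrite /Xnext big_pred0 ?mulr0 ?scaler0 // => j.
by apply/negP => /eqP e; apply: no; exists j.
Qed.

(** ** Straightening the loops *)

Section Straightening.
Variable mu : 'I_nslots -> K.

(** Subtracting [mu_i x_(i-1)'] from the loop [x_i] turns [x_i x_(i+1)] into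
    [x_i x_(i+1) - mu_i x_(i-1)' x_(i+1)], and [x_(i-1)' x_i] into
    [x_(i-1)' x_i - mu_i x_(i-1)' x_(i-1)'], whose last term is a square up to
    rotation. As two loops are never adjacent there is no second-order term. *)
Definition str_eta i : A := if loop i then mu i *: Xprev i else 0.

Lemma str_parallel : slot_parallel str_eta.
Proof.
move=> i; rewrite /str_eta; case: ifP => [li|_]; last exact: parallel0.
apply: parallelZ; rewrite -(loop_eq li).
rewrite /Xprev; elim/big_rec: _ => [|k x /eqP e h]; first exact: parallel0.
by apply: parallelD => //; rewrite -(meet e); apply: parallel_Xi'.
Qed.

Notation th := (kill str_parallel).

Lemma deg_filt_Xi' k : deg_filt 2 (Xi' k).
Proof.
apply: (filtM _ (@filt_Bi n I K deg_wt k) (@filt_Ai n I K deg_wt k)).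
by have := wX_deg (nth_slot k); rewrite wX_AB /wB /wA addnC => ->.
Qed.

Lemma str_bounded : bounded deg_wt th.
Proof.
apply: slotsub_bounded => i; apply: filtB; first exact: filt_Bi.
rewrite /str_eta; case: ifP => [li|_]; last exact: filt_0.
apply: filtZ; apply: filt_sum => k _; apply: filt_le (@deg_filt_Xi' k).
by rewrite /wB deg_wt_bwd li.
Qed.

Lemma str_unipotent : unipotent ord_wt 1 th.
Proof.
apply: slotsub_unipotent => i; rewrite addrAC subrr add0r; apply: filtN.
rewrite /str_eta; case: ifP => [li|_]; last exact: filt_0.
apply: filtZ; apply: filt_sum => k /eqP e; apply: filt_le (@filt_Xi' n I K k).
have := @Xord_succ n I k i; rewrite e ltnSn => /(_ isT).
by have := @wAB n I i; lia.
Qed.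

Lemma str_nonloop i : ~~ loop i -> str_eta i = 0.
Proof. by rewrite /str_eta => /negbTE ->. Qed.

Lemma str_Xi i : ~~ loop i -> sub th (Xi i) = Xi i.
Proof. by move=> l; rewrite kill_Xi str_nonloop // mulr0 subr0. Qed.

Lemma str_Xi' i : ~~ loop i -> sub th (Xi' i) = Xi' i.
Proof. by move=> l; rewrite kill_Xi' str_nonloop // mul0r subr0. Qed.

Lemma loop_pred i k : i = k.+1 :> nat -> loop i -> ~~ loop k.
Proof. by move=> e li; apply/negP => lk; have := loop_succ e lk; rewrite li. Qed.

Lemma str_Yi i : sub th (Yi i) = Yi i.
Proof.
rewrite /Yi; case: ifP => [li|_]; last exact: linear0.
rewrite sub_mul !sub_sum; congr (_ * _); apply: eq_bigr => k /eqP e.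
  by apply: str_Xi'; apply: loop_pred li.
by apply: str_Xi; apply: loop_succ li.
Qed.

(** What straightening subtracts from the coefficient of [x_i^2]: at most one
    term, coming from a loop right after slot [i]. *)
Definition correction i : K := \sum_(j < nslots | (j == i.+1 :> nat) && loop j) mu j.

Lemma str_base_term i : cyc_equiv (sub th (Xi' i * Xnext i))
  (Xi' i * Xnext i - mu i *: Yi i - correction i *: Xi i ^+ 2).
Proof.
rewrite sub_mul kill_Xi' kill_Xnext.
have D1 : str_eta i * Ai i * Xnext i = mu i *: Yi i.
  rewrite /str_eta /Yi; case: ifP => [li|_]; last by rewrite !mul0r scaler0.
  by rewrite -mulrA Ai_Xnext // scaleAl.
have D2 : str_eta i * Ai i * dnext str_eta i = 0.
  case li : (loop i); last by rewrite str_nonloop ?li // !mul0r.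
  rewrite /dnext big1 ?mulr0 // => j /eqP e.
  by rewrite str_nonloop ?mulr0 //; apply: loop_succ li.
have D3 : Xi' i * dnext str_eta i = correction i *: (Xi' i * Xi' i).
  rewrite /dnext mulr_sumr /correction scaler_suml [RHS]big_mkcondr.
  apply: eq_bigr => j /eqP e; rewrite /str_eta; case: ifP => [lj|_]; last by rewrite !mulr0.
  rewrite -!scaleAr (Xprev_succ K e) (Ai_loop K lj) -(loop_eq lj) -(meet e).
  by rewrite (parallel_idl (@parallel_Xi' K n I i)).
rewrite mulrBl !mulrBr D1 D2 D3 subr0 addrAC.
apply: cyc_add; first exact: cyc_refl.
by apply: cyc_opp; apply: cyc_scale; apply: cyc_sym; apply: cyc_square.
Qed.

Lemma str_quad ka : (forall i, loop i -> ka i = 0) ->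
  cyc_equiv (sub th (base_potential + \sum_(i < nslots) (ka i *: Xi i ^+ 2 + mu i *: Yi i)))
            (base_potential + \sum_(i < nslots) (ka i - correction i) *: Xi i ^+ 2).
Proof.
move=> kl; rewrite /base_potential -!big_split sub_sum; apply: cyc_sum => i _ /=.
rewrite !subD !subZ str_Yi.
have -> : ka i *: sub th (Xi i ^+ 2) = ka i *: Xi i ^+ 2.
  by case li : (loop i); [rewrite kl // !scale0r|rewrite sub_exp str_Xi ?li].
apply: cyc_trans (cyc_add (str_base_term i) (cyc_refl _)) _; apply: cyc_eq.
rewrite scalerBl; set a := Xi' i * _; set b := mu i *: _; set c := correction i *: _.
by apply: cpath_algP => p; rewrite !coef_add !coef_opp; ring.
Qed.

End Straightening.

Lemma deg_ord_filt N h : deg_filt N h -> ord_filt (N * (9 * n)) h.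
Proof.
move=> hN p lt; apply: hN; rewrite ltnNge; apply/negP => le.
have H : (wt deg_wt p * (9 * n) <= wt ord_wt p)%N.
  rewrite /wt; elim: (parrows p) => [|a s IH]; first by rewrite wts_nil.
  by rewrite !wts_cons mulnDl leq_add // mulnC ord_wt_deg.
by have := leq_trans (leq_mul le (leqnn (9 * n)%N)) H; rewrite leqNgt lt.
Qed.

(** Scaling and straightening both preserve the degree, so the part of degree at
    least 5 stays beyond weight [45 n], where [kill_level] applies. *)
Lemma normalize f : (0 < n)%N -> reduced_typeA f ->
  exists (D th : substitution K Qd) (ka : 'I_nslots -> nat -> K) h,
    [/\ bijective (sub D), unipotent ord_wt 1 th, ord_filt (45 * n) h
      & cyc_equiv (sub th (sub D f)) (base_potential + Vpow ka + h)].
Proof.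
move=> n0 [pf rf ct]; have [q [ka [la [mu [kl eq]]]] hq] := quad_split pf rf.
have ef : cyc_equiv f (quad ka la mu + (f - q)).
  rewrite -{1}(subrK q f) addrC; apply: cyc_add => //; exact: cyc_refl.
have la0 i j : j = i.+1 :> nat -> la i != 0.
  by move=> ij; apply: quad_coef_neq0 ij _ _ _ _ _ (ct _ _ ij) hq ef.
pose la' m := if insub m is Some i then if la i == 0 then 1 else la i else 1.
have la'0 m : la' m != 0.
  rewrite /la'; case: insub => [i|]; last exact: oner_neq0.
  by case: ifP => [_|/negbT //]; apply: oner_neq0.
pose t := scale_factor la'; have t0 m : t m != 0 by apply: scale_factor_neq0.
have lat i j : j = i.+1 :> nat -> la i * (t i * t i.+1) = 1.
  move=> ij; have -> : t i.+1 = (la i * t i)^-1.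
    by rewrite /t /= /la' valK (negbTE (la0 _ _ ij)).
  by rewrite mulrA mulfV // mulf_neq0 // (la0 _ _ ij).
pose D := scaling t; pose mu' i := mu i * (t i.-1 * t i.+1).
pose ka' i := ka i * (t i * t i).
pose ka2 (i : 'I_nslots) d := if d == 2%N then ka' i - correction mu' i else 0.
exists D, (kill (@str_parallel mu')), ka2, (sub (kill (@str_parallel mu')) (sub D (f - q))).
split.
- exact: scaling_bij.
- exact: str_unipotent.
- have -> : (45 * n = 5 * (9 * n))%N by lia.
  apply: deg_ord_filt; apply: sub_filt; first exact: str_bounded.
  by apply: sub_filt hq; apply: scaling_bounded.
apply: cyc_trans (sub_cyc _ (sub_cyc _ ef)) _.
rewrite [sub D (_ + _)]subD [X in cyc_equiv X _]subD scaling_quad quad_base //.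
apply: cyc_add; last exact: cyc_refl.
rewrite (@Vpow_concentrated _ _ _ _ 2) // => [|i d /negbTE]; last by rewrite /ka2 => ->.
by apply: str_quad => i li; rewrite kl ?mul0r.
Qed.

End Normalization.

(** * The limit *)

Lemma dependent_choice_nat (T : Type) (S : nat -> T -> Prop) (R : nat -> T -> T -> Prop) x0 :
  S 0%N x0 -> (forall k x, S k x -> exists y, S k.+1 y /\ R k x y) ->
  exists s : nat -> T, forall k, S k (s k) /\ R k (s k) (s k.+1).
Proof.
move=> S0 step.
have next k (x : {x | S k x}) : {y : {y | S k.+1 y} | R k (sval x) (sval y)}.
  have [y [Sy Ry]] := cid (step k (sval x) (svalP x)).
  by exists (exist _ y Sy).
pose s := nat_rect (fun k => {x | S k x}) (exist _ x0 S0) (fun k x => sval (next k x)).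
exists (fun k => sval (s k)) => k; split; first exact: svalP (s k).
exact: svalP (next k (s k)).
Qed.

Section Limit.
Variables (K : fieldType) (n : nat) (I : {set 'I_n}).
Notation Qd := (double_quiver I).
Notation nslots := (nslots I).
Notation A := (cpath_alg K Qd).
Notation ord_wt := (@ord_wt n I).
Notation ord_filt := (@filt K Qd ord_wt).
Notation base_potential := (@base_potential n I K).
Implicit Types (i : 'I_nslots) (a : arrow Qd) (f g h : A) (ka : 'I_nslots -> nat -> K).
Implicit Types (d k N : nat).

Lemma ord_filt_adic N f : ord_filt (N * (22 * n)).+1 f -> in_adic N f.
Proof. by apply: filt_adic => a; have /andP[] := ord_wt_bound a. Qed.

Lemma VpowB ka ka' : Vpow (fun i d => ka i d - ka' i d) = Vpow ka - Vpow ka' :> A.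
Proof.
rewrite -[- Vpow ka']scaleN1r -VpowZ -VpowD; congr Vpow.
by apply: funext => i; apply: funext => d; rewrite mulN1r.
Qed.

(** Iterate [kill_level]. The step at weight [N = 45 n + k] moves every arrow by
    at least [N - 44 n >= k + 1] and changes the coefficient of [x_i^d] only if
    that power has weight [N]. So both the images of the arrows and the
    coefficients are eventually constant at each path and each power. *)
Lemma monomialize g th0 ka0 h0 : (0 < n)%N -> unipotent ord_wt 1 th0 ->
  ord_filt (45 * n) h0 -> cyc_equiv (sub th0 g) (base_potential + Vpow ka0 + h0) ->
  exists (th : substitution K Qd) ka,
    unipotent ord_wt 1 th /\ cyc_equiv (sub th g) (base_potential + Vpow ka).
Proof.
move=> n0 u0 hh0 e0.
pose S k (x : substitution K Qd * ('I_nslots -> nat -> K)) := unipotent ord_wt 1 x.1 /\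
  exists2 h, ord_filt (45 * n + k) h & cyc_equiv (sub x.1 g) (base_potential + Vpow x.2 + h).
pose R k (x y : substitution K Qd * ('I_nslots -> nat -> K)) :=
  (forall a, ord_filt (ord_wt a + k) (y.1 a - x.1 a)) /\
  (forall i d, y.2 i d = x.2 i d \/ (d * Xord i = 45 * n + k)%N).
have [||s sP] := @dependent_choice_nat _ S R (th0, ka0).
- by split=> //; exists h0; rewrite ?addn0.
- move=> k [th ka] [/= uth [h hh e]].
  have [|th' [ka' [h' [uth' kaP hh' e']]]] := kill_level n0 _ hh e; first by lia.
  have T a : ord_filt (ord_wt a + k.+1) (sub th' (th a) - th a).
    have B : ord_filt (ord_wt a) (th a) by apply: unipotent_bounded uth a.
    by apply: filt_le (sub_unipotent uth' B); lia.
  exists (scomp th' th, ka'); split; last first.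
    by split=> //= a; apply: filt_le (T a); lia.
  split=> [a /=|].
    rewrite -(subrK (th a) (sub th' (th a))) -addrA; apply: filtD; last exact: uth.
    by apply: filt_le (T a); lia.
  by exists h'; [rewrite addnS|rewrite sub_scomp].
have C a k : ord_filt (ord_wt a + k) ((s k.+1).1 a - (s k).1 a) by have [_ []] := sP k.
pose img a := flim ord_wt (fun k => (s k).1 a).
have imgP a : parallel (qtail a) (qhead a) (img a).
  by move=> p ne; apply: (simgP (s (wt ord_wt p).+1).1 a).
pose th := Substitution imgP.
have L a k : ord_filt (ord_wt a + k) (th a - (s k).1 a) by apply: flimP (C a) k.
have uth : unipotent ord_wt 1 th.
  move=> a; rewrite -(subrK ((s 1%N).1 a) (th a)) -addrA; apply: filtD; first exact: L.
  by have [[]] := sP 1%N.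
(* the power [x_i^d] has weight [d * Xord i] and is settled by then *)
pose ka i d := (s (d * Xord i).+1).2 i d.
have stable i d k : (d * Xord i < k)%N -> (s k).2 i d = ka i d.
  elim: k => // k IH; rewrite ltnS leq_eqVlt => /predU1P[<-//|lt].
  by have [_ [_ /(_ i d) [->|e]]] := sP k; [exact: IH|move: lt; rewrite e; lia].
have V k : ord_filt k (Vpow (s k).2 - Vpow ka : A).
  rewrite -VpowB; apply: Vpow_filt => i d _; case: (ltnP (d * Xord i) k) => // /stable ->.
  by rewrite subrr eqxx.
exists th, ka; split=> //; apply: cyc_lim => N.
pose k := (N * (22 * n)).+1; have [[uk [h hh e]] _] := sP k.
exists (sub (s k).1 g - (base_potential + Vpow (s k).2 + h)); split.
  by rewrite /cyc_equiv subr0; apply: e.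
apply: ord_filt_adic; rewrite -/k.
have -> : sub th g - (base_potential + Vpow ka) - (sub (s k).1 g - (base_potential + Vpow (s k).2 + h))
   = (sub th g - sub (s k).1 g) + h + (Vpow (s k).2 - Vpow ka).
  set x := sub th g; set y := sub _ g; set v := Vpow ka; set w := Vpow _.
  by apply: cpath_algP => p; rewrite !coef_lin; ring.
apply: filtD => //; apply: filtD; last by apply: filt_le hh; lia.
rewrite -[k in ord_filt k]add0n; apply: sub_close => //.
- exact: unipotent_bounded uth.
- exact: unipotent_bounded uk.
Qed.

Lemma monomialized_partialE ka N : monomialized_partial ka N = base_potential + powers ka N.
Proof.
congr (_ + _); last first.
  by apply: eq_bigr => i _; apply: eq_bigr => d _; rewrite monom_xpathE.
apply: eq_bigr => i _; rewrite mulr_sumr; apply: eq_bigr => j _.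
by rewrite monom_xpath'E monom_xpathE.
Qed.

(** Substitutions preserve the ends of paths and do not shorten them, so the image
    of [f] is again a reduced potential. *)
Theorem monomialization f : (0 < n)%N -> reduced_typeA f ->
  exists (f' : A) (rho : {rmorphism A -> A}),
    [/\ right_equivalence rho f f', reduced f' & monomialized_typeA f'].
Proof.
move=> n0 tf; have [pf rf _] := tf.
have [D [th0 [ka0 [h0 [bD u0 hh0 e0]]]]] := normalize n0 tf.
have [th [ka [uth e]]] := monomialize n0 u0 hh0 e0.
pose rho : {rmorphism A -> A} := sub th \o sub D.
have rhoZ : scalable rho by move=> x g; rewrite /= !subZ.
exists (sub th (sub D f)), rho; split.
- split=> //; last exact: cyc_refl.
    by apply: bij_comp bD; apply: sub_bij uth.
  by move=> x; rewrite rhoZ rmorph1.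
- by apply: sub_reduced; [apply: sub_potential|apply: sub_reduced].
split; first by do 2?apply: sub_potential.
exists ka, (base_potential + Vpow ka); split=> // N; exists N => k le p lt.
rewrite monomialized_partialE opprD addrACA subrr add0r.
by apply: (Vpow_powers ka); apply: leq_trans le.
Qed.

End Limit.

Theorem theorem4p20 (R : realType) (n : nat) (I : {set 'I_n})
    (f : cpath_alg (complex R) (double_quiver I)) :
  (1 <= n)%N ->
  reduced_typeA f ->
  exists (f' : cpath_alg (complex R) (double_quiver I))
         (rho : {rmorphism cpath_alg (complex R) (double_quiver I) ->
                           cpath_alg (complex R) (double_quiver I)}),
    [/\ right_equivalence rho f f', reduced f' & monomialized_typeA f'].
Proof. exact: monomialization. Qed.
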